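(* For every graph $G$, $\overline{mnl_n}(\overline{DG})\leq mnl_n(G)\cdot 2^n$.
   Context: Graphs are finite and embeddings are (tame) embeddings in $\mathbb{R}^3$; $n\ge 2$ denotes a number of link components. For an undirected graph $G$, $\overline{DG}$ is the symmetric digraph formed by replacing each edge $v_1v_2$ of $G$ with the two directed edges $v_1v_2$ and $v_2v_1$. A cycle in a digraph is consistently oriented if it is a directed cycle (a pair of oppositely directed edges $uv$, $vu$ is a consistently oriented 2-cycle). An $n$-component link in an embedding of a graph is given by a set of $n$ pairwise disjoint cycles of the graph; it is consistently oriented (in a digraph) if all of these cycles are consistently oriented. Links are distinct if they are given by different sets of cycles. A link is non-split if no embedded 2-sphere in its complement separates some of its components from the others. $mnl_n(G)$ is the minimum over all embeddings of $G$ of the number of distinct non-split $n$-component links. For a digraph $\overline{G}$, $\overline{mnl_n}(\overline{G})$ is the minimum over all embeddings of $\overline{G}$ of the number of distinct consistently oriented non-split $n$-component links. *)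

(* Defs.v *)
From HB Require Import structures.
From mathcomp Require Import all_boot all_order all_algebra.
From mathcomp Require Import all_classical all_reals.
From mathcomp Require Import topology normedtype.

Set Implicit Arguments.
Unset Strict Implicit.
Unset Printing Implicit Defensive.

Import Order.TTheory GRing.Theory Num.Theory.
Import numFieldNormedType.Exports.

Local Open Scope classical_set_scope.
Local Open Scope ring_scope.

(* Parallel edges are needed because the embeddings of a digraph are those of
   its underlying undirected graph; loops are allowed.  The order in which
   [ends] lists the two endpoints of an undirected edge carries no meaning. *)
Record graph := Graph {
  vertex : finType;
  edge : finType;
  ends : edge -> vertex * vertex }.

Record digraph := Digraph {
  dvertex : finType;
  dedge : finType;
  source : dedge -> dvertex;
  target : dedge -> dvertex }.

Definition underlying (D : digraph) : graph :=
  @Graph (dvertex D) (dedge D) (fun e => (source e, target e)).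

(* A dart [(e, b)] is the edge [e] traversed in one of its two directions. *)
Definition dart (G : graph) : finType := (edge G * bool)%type.

Definition tail (G : graph) (d : dart G) : vertex G :=
  if d.2 then (ends d.1).2 else (ends d.1).1.

Definition head (G : graph) (d : dart G) : vertex G :=
  if d.2 then (ends d.1).1 else (ends d.1).2.

Definition symmetric_digraph (G : graph) : digraph :=
  @Digraph (vertex G) (dart G) (@tail G) (@head G).

(* Cycles are identified with their edge sets.  Requiring distinct edges
   excludes traversing a single edge back and forth. *)
Definition is_cycle (G : graph) (C : {set edge G}) : Prop :=
  exists s : seq (dart G),
    [/\ s != [::], path.cycle [rel d d' | head d == tail d'] s,
        uniq (map (@tail G) s), uniq (map fst s) & C =i map fst s].

Definition is_dicycle (D : digraph) (C : {set dedge D}) : Prop :=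
  exists s : seq (dedge D),
    [/\ s != [::], path.cycle [rel d d' | target d == source d'] s,
        uniq (map (@source D) s) & C =i s].

Definition incident (G : graph) (e : edge G) (v : vertex G) : bool :=
  (v == (ends e).1) || (v == (ends e).2).

Definition disjoint_cycles (G : graph) (C C' : {set edge G}) : Prop :=
  forall (e e' : edge G) (v : vertex G),
    e \in C -> e' \in C' -> ~~ (incident e v && incident e' v).

Definition is_link (G : graph) (n : nat) (L : {set {set edge G}}) : Prop :=
  [/\ #|L| = n,
      forall C, C \in L -> is_cycle C &
      forall C C', C \in L -> C' \in L -> C != C' -> disjoint_cycles C C'].

Definition consistently_oriented (D : digraph)
    (L : {set {set edge (underlying D)}}) : Prop :=
  forall C, C \in L -> is_dicycle (D := D) C.

Section Space.
Variable R : realType.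

Notation space := 'rV[R]_3.

(* A map of the geometric realization of [G], given on each edge by a
   parametrization by [0, 1]; the last three conditions say that it is
   injective. *)
Record embedding (G : graph) := Embedding {
  pos : vertex G -> space;
  arc : edge G -> R -> space;
  arc_continuous : forall e, {within `[0, 1], continuous (arc e)};
  arc0 : forall e, arc e 0 = pos (ends e).1;
  arc1 : forall e, arc e 1 = pos (ends e).2;
  pos_inj : injective pos;
  arc_pos : forall e v t, 0 < t < 1 -> arc e t <> pos v;
  arc_inj : forall e e' t t', 0 < t < 1 -> 0 < t' < 1 ->
    arc e t = arc e' t' -> e = e' /\ t = t' }.

Definition homeomorphism (h : space -> space) : Prop :=
  continuous h /\
  exists k : space -> space, [/\ continuous k, cancel h k & cancel k h].

Definition segment (a b : space) : set space :=
  [set a + t *: (b - a) | t in `[0, 1]].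

(* [g] maps each interval of some subdivision of [0, 1] onto a segment. *)
Definition polygonal (g : R -> space) : Prop :=
  exists s : seq R,
    [/\ path <%R 0 s, last 0 s = 1 &
        forall i, (i < size s)%N ->
          let a := nth 0 (0 :: s) i in let b := nth 0 s i in
          g @` `[a, b] = segment (g a) (g b)].

(* A self-homeomorphism of space makes the whole embedded graph polygonal. *)
Definition tame (G : graph) (f : embedding G) : Prop :=
  exists h : space -> space,
    homeomorphism h /\ forall e, polygonal (h \o arc f e).

Definition unit_sphere : set space := [set x | \sum_i x 0 i ^+ 2 = 1].

Definition embedded_sphere (S : set space) : Prop :=
  exists g : space -> space,
    [/\ {within unit_sphere, continuous g}, set_inj unit_sphere g &
        S = g @` unit_sphere].

Definition component (G : graph) (f : embedding G) (C : {set edge G}) :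
  set space := \bigcup_(e in [set` C]) (arc f e @` `[0, 1]).

(* [A] lists the components that [S] separates from the others. *)
Definition split (G : graph) (f : embedding G) (L : {set {set edge G}}) :
  Prop :=
  exists (S : set space) (A : {set {set edge G}}),
    [/\ embedded_sphere S,
        forall C, C \in L -> component f C `&` S = set0,
        A != finset.set0, A \proper L &
        forall C C', C \in A -> C' \in L -> C' \notin A ->
          forall x y, component f C x -> component f C' y ->
            ~ connected_component (~` S) x y].

Definition nb_nonsplit_links (n : nat) (G : graph) (f : embedding G) : nat :=
  #|[pred L : {set {set edge G}} | `[< is_link n L /\ ~ split f L >]]|.

Definition nb_oriented_nonsplit_links (n : nat) (D : digraph)
    (f : embedding (underlying D)) : nat :=
  #|[pred L : {set {set edge (underlying D)}} |
      `[< [/\ is_link n L, consistently_oriented L & ~ split f L] >]]|.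

(* The least element of [A]; the default value 0 is only taken when [A] is
   empty, and every finite graph has a tame embedding. *)
Definition minimum (A : set nat) : nat :=
  xget 0%N [set k | A k /\ forall m, A m -> (k <= m)%N].

Definition mnl (n : nat) (G : graph) : nat :=
  minimum [set nb_nonsplit_links n f | f in @tame G].

Definition dmnl (n : nat) (D : digraph) : nat :=
  minimum [set nb_oriented_nonsplit_links n f | f in @tame (underlying D)].

End Space.

(* Main.v *)
Require Import Defs.
From mathcomp Require Import all_boot all_order all_algebra.
From mathcomp Require Import all_classical all_reals.
From mathcomp Require Import topology normedtype derive.
From mathcomp Require Import ring lra.
Import Defs.

Set Implicit Arguments.
Unset Strict Implicit.
Unset Printing Implicit Defensive.

Import Order.TTheory GRing.Theory Num.Theory.
Import numFieldNormedType.Exports.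

Local Open Scope classical_set_scope.
Local Open Scope ring_scope.

(** Start from a tame embedding [f] of [G] with the fewest non-split links; by a
    homeomorphism of space it may be taken polygonal ([tame_polygonal]).  Embed
    the symmetric digraph by letting one copy of each edge follow the old arc
    and the other one a polygonal arc very close to it ([doubled_embedding]).
    The copies are obtained by moving all edges in one direction [w], along a
    profile that vanishes at the vertices.  If [w] avoids the planes spanned by
    pairs of segments of the embedded graph, and the displacement is small, then
    no new intersections appear ([transverse_direction]).

    A consistently oriented link of the digraph has components of two kinds.

    A component that uses both copies of an edge consists of these two copies.
    It is then split off from the rest.  Indeed an arc that is not closed can be
    shrunk into a small ball by a homeomorphism that moves nothing far from the
    arc: a push along a segment shrinks one straight piece ([shrink_segment]),
    and induction on the pieces gives the whole arc ([shrink_arc]).  Bringing a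
    round sphere back by this homeomorphism gives a sphere around the edge
    ([split_apart_arc], [two_way_split]).

    If all components are of the other kind, the link projects to a link of [G]
    with the same number of components.  When the latter is split, the
    separating sphere is at a positive distance from it, and so separates the
    nearby components of the former as well ([split_apart_near],
    [project_split]); no isotopy is needed, nor any tameness of the sphere.  As
    there are finitely many sets of edges, one closeness works for all spheres
    in question ([split_apart_radius]).

    So non-split oriented links project to non-split links of [G], and at most
    [2 ^ n] of them have the same projection, since a directed cycle without
    backtracking is determined by its projection and the direction in which it
    runs through one edge ([project_sub], [oriented_link_count]). *)

(** * Homeomorphisms of space *)

Section Homeomorphisms.
Variable R : realType.
Notation space := 'rV[R]_3.
Implicit Types (h k : space -> space) (F K U : set space) (x y u : space).

Lemma homeomorphism_id : homeomorphism (id : space -> space).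
Proof. by split; [move=> x; exact: cvg_id|exists id; split=> // x; exact: cvg_id]. Qed.

Lemma homeomorphism_comp h k :
  homeomorphism h -> homeomorphism k -> homeomorphism (h \o k).
Proof.
move=> [ch [h' [ch' hK h'K]]] [ck [k' [ck' kK k'K]]]; split.
  by move=> x; apply: continuous_comp; [exact: ck|exact: ch].
exists (k' \o h'); split.
- by move=> x; apply: continuous_comp; [exact: ch'|exact: ck'].
- by move=> x /=; rewrite hK kK.
- by move=> x /=; rewrite k'K h'K.
Qed.

Lemma homeomorphism_iter h n : homeomorphism h -> homeomorphism (iter n h).
Proof.
move=> hh; elim: n => [|n IHn]; first exact: homeomorphism_id.
exact: (homeomorphism_comp hh IHn).
Qed.

Lemma within_continuous_comp (T U V : topologicalType) (A : set T)
    (f : T -> U) (g : U -> V) :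
  {within A, continuous f} -> continuous g -> {within A, continuous (g \o f)}.
Proof.
move=> cf cg x; have := @continuous_comp (subspace A) U V f g x.
by apply; [exact: cf|exact: cg].
Qed.

Lemma lipschitz_continuous (V W : normedModType R) (c : R) (f : V -> W) :
  (forall v w : V, `|f v - f w| <= c * `|v - w|) -> continuous f.
Proof.
move=> flip x; apply/cvgrPdist_lt => e e0.
have c0 : 0 < `|c| + 1 by rewrite ltr_wpDl.
near=> y; apply: (le_lt_trans (flip x y)).
apply: (@le_lt_trans _ _ ((`|c| + 1) * `|x - y|)).
  by apply: ler_wpM2r => //; apply: le_trans (ler_norm c) _; rewrite lerDl.
rewrite mulrC -ltr_pdivlMr //.
near: y; apply/nbhs_ballP; exists (e / (`|c| + 1)); first by rewrite /= divr_gt0.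
by move=> y; rewrite -ball_normE.
Unshelve. all: by end_near. Qed.

Lemma normr_half : `|2^-1 : R| = 2^-1.
Proof. by rewrite gtr0_norm // invr_gt0. Qed.

Definition dist F x : R := inf [set `|x - y| | y in F].

Lemma dist_has_inf F x : F !=set0 -> has_inf [set `|x - y| | y in F].
Proof.
move=> [y Fy]; split; first by exists `|x - y|; exists y.
by exists 0 => _ [z _ <-].
Qed.

Lemma dist_ge0 F x : 0 <= dist F x.
Proof.
rewrite /dist; have [->|/set0P F0] := eqVneq F set0.
  by rewrite image_set0 inf0.
apply: lb_le_inf; first exact: (dist_has_inf x F0).1.
by move=> _ [z _ <-].
Qed.

Lemma dist_le F x y : F y -> dist F x <= `|x - y|.
Proof.
move=> Fy; apply: ge_inf; last by exists y.
by apply: (dist_has_inf _ _).2; exists y.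
Qed.

Lemma dist0 F x : F x -> dist F x = 0.
Proof.
by move=> /(@dist_le _ x); rewrite subrr normr0 => h; apply/le_anti; rewrite h dist_ge0.
Qed.

Lemma dist_gt0 F x : F !=set0 -> closed F -> ~ F x -> 0 < dist F x.
Proof.
move=> F0 /closed_openC oF Fx.
have /nbhs_ballP[e /= e0 eF] : nbhs x (~` F) by exact: open_nbhs_nbhs.
apply: (lt_le_trans e0); apply: lb_le_inf; first exact: (dist_has_inf x F0).1.
move=> _ [z Fz <-]; rewrite leNgt; apply/negP => xz.
by apply: (eF z) => //; rewrite -ball_normE.
Qed.

Lemma dist_lipschitz F x y : `|dist F x - dist F y| <= `|x - y|.
Proof.
have [->|/set0P F0] := eqVneq F set0.
  by rewrite /dist !image_set0 inf0 subrr normr0.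
suff lip a b : dist F a - dist F b <= `|a - b|.
  by rewrite ler_norml lip andbT lerNl opprB distrC lip.
rewrite lerBlDl -lerBlDr; apply: lb_le_inf; first exact: (dist_has_inf b F0).1.
move=> _ [z Fz <-]; rewrite lerBlDr; apply: (le_trans (dist_le a Fz)).
have -> : a - z = (b - z) + (a - b) by rewrite [RHS]addrC subrKA.
exact: ler_normD.
Qed.

Lemma dist_continuous F : continuous (dist F).
Proof.
by apply: (@lipschitz_continuous _ _ 1) => x y; rewrite mul1r dist_lipschitz.
Qed.

(** The factor 1/2 makes the displacement a contraction, which is what makes
    the push invertible. *)
Definition push F u x : space := x + (dist F x / 2) *: u.

Lemma push_fix F u x : F x -> push F u x = x.
Proof. by move=> Fx; rewrite /push dist0 // mul0r scale0r addr0. Qed.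

Lemma push_lipschitz F u x y :
  `|u| <= 1 -> `|push F u x - push F u y| <= 2 * `|x - y|.
Proof.
move=> u1; rewrite /push opprD addrACA -scalerBl -mulrBl.
apply: (le_trans (ler_normD _ _)); rewrite normrZ.
have := dist_lipschitz F x y; rewrite normrM normr_half.
have : 0 <= `|dist F x - dist F y| by [].
have : 0 <= `|u| by [].
by move: u1; set a := `|u|; set b := `|dist _ _ - _|; nra.
Qed.

Lemma push_expand F u x y :
  `|u| <= 1 -> `|x - y| <= 2 * `|push F u x - push F u y|.
Proof.
move=> u1.
have -> : x - y = (push F u x - push F u y) - ((dist F x - dist F y) / 2) *: u.
  by rewrite /push opprD addrACA -scalerBl -mulrBl addrK.
set p := _ - push _ _ _.
have pE : x - y = p - ((dist F x - dist F y) / 2) *: u.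
  by rewrite /p /push opprD addrACA -scalerBl -mulrBl addrK.
have := dist_lipschitz F x y; have := ler_normB p (((dist F x - dist F y) / 2) *: u).
rewrite -pE normrZ normrM normr_half.
have : 0 <= `|dist F x - dist F y| by [].
have : 0 <= `|u| by [].
by move: u1; set a := `|u|; set b := `|dist _ _ - _|; nra.
Qed.

(** The point to be sent to [y] is sought on the line through [y] in the
    direction of the push, where the intermediate value theorem applies. *)
Lemma push_surj F u y : `|u| <= 1 -> exists x, push F u x = y.
Proof.
move=> u1; pose g (t : R) := t - dist F (y - t *: u) / 2.
have cg : continuous g.
  apply: (@lipschitz_continuous _ _ 2) => s t; rewrite /g.
  have -> : s - dist F (y - s *: u) / 2 - (t - dist F (y - t *: u) / 2) =
    (s - t) - (dist F (y - s *: u) - dist F (y - t *: u)) / 2 by ring.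
  apply: (le_trans (ler_normB _ _)).
  have := dist_lipschitz F (y - s *: u) (y - t *: u).
  have -> : y - s *: u - (y - t *: u) = (t - s) *: u.
    by rewrite opprB addrC addrA subrK scalerBl.
  rewrite normrZ normrM normr_half (distrC t s).
  have : 0 <= `|s - t| by []. have : 0 <= `|u| by [].
  by move: u1; set a := `|u|; set b := `|dist _ _ - _|; set c := `|s - t|; nra.
have d0 := dist_ge0 F y.
have [||t _ gt0] := @IVT _ g 0 (dist F y) 0 d0.
- exact: continuous_subspaceT.
- rewrite /g scale0r subr0 sub0r.
  have := dist_lipschitz F (y - dist F y *: u) y.
  rewrite -addrA addrC subrK normrN normrZ (ger0_norm d0) => dl.
  have : dist F (y - dist F y *: u) - dist F y <= dist F y * `|u|.
    by apply: le_trans (ler_norm _) dl.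
  have : 0 <= `|u| by []. move: u1.
  rewrite ge_min le_max; set a := `|u|; set b := dist F (_ - _) => *.
  by apply/andP; split; apply/orP; [left; lra|right; nra].
exists (y - t *: u); rewrite /push.
have <- : t = dist F (y - t *: u) / 2 by move: gt0; rewrite /g; lra.
by rewrite subrK.
Qed.

Lemma push_homeomorphism F u : `|u| <= 1 -> homeomorphism (push F u).
Proof.
move=> u1; split.
  by apply: (@lipschitz_continuous _ _ 2) => x y; exact: push_lipschitz.
pose k y := projT1 (cid (push_surj F y u1)).
have kK y : push F u (k y) = y by rewrite /k; case: cid.
exists k; split => //.
  apply: (@lipschitz_continuous _ _ 2) => x y.
  by have := push_expand F (k x) (k y) u1; rewrite !kK.
move=> x; apply/eqP; rewrite -subr_eq0 -normr_le0.
by have := push_expand F (k (push F u x)) x u1; rewrite kK subrr normr0 mulr0.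
Qed.

End Homeomorphisms.

(** * Shrinking polygonal arcs *)

Section Shrinking.
Variable R : realType.
Notation space := 'rV[R]_3.
Implicit Types (h k : space -> space) (F K U : set space) (x y u A B : space).

Lemma segmentP A B x :
  segment A B x <-> exists2 s : R, 0 <= s <= 1 & x = A + s *: (B - A).
Proof.
split=> [[s /=]|[s s01 ->]]; first by rewrite in_itv /= => s01 <-; exists s.
by exists s; rewrite //= in_itv.
Qed.

Lemma segment_left A B : segment A B A.
Proof. by apply/segmentP; exists 0; rewrite ?lexx ?ler01 // scale0r addr0. Qed.

Lemma segment_right A B : segment A B B.
Proof. by apply/segmentP; exists 1; rewrite ?lexx ?ler01 // scale1r addrC subrK. Qed.

Lemma segment_sym A B : segment A B = segment B A.
Proof.
suff sub (C D : space) : segment C D `<=` segment D C by apply/seteqP; split; exact: sub.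
move=> x /segmentP[s s01 ->]; apply/segmentP; exists (1 - s); first lra.
by apply/rowP => i; rewrite !mxE; ring.
Qed.

(** Iterating a push along the segment moves all of it towards [B], since the
    push only slows down near [K] and the complement of [U]; so it stops
    nowhere on the segment but at [B]. *)
Lemma shrink_segment U K A B (r : R) :
  open U -> closed K -> K B -> segment A B `<=` U ->
  (forall x, segment A B x -> K x -> x = B) -> 0 < r ->
  exists h, [/\ homeomorphism h, forall x, ~ U x -> h x = x,
    forall x, K x -> h x = x & forall x, segment A B x -> `|h x - B| < r].
Proof.
move=> oU cK KB sU sK r0; have [AB|AB] := eqVneq A B.
  exists id; split=> //; first exact: homeomorphism_id.
  move=> x /segmentP[s _ ->].
  by rewrite AB subrr scaler0 addr0 subrr normr0.
pose F := ~` U `|` K; pose L := `|A - B|.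
have L0 : 0 < L by rewrite normr_gt0 subr_eq0.
have FB : F B by right.
have cF : closed F by apply: closedU => //; exact: open_closedC.
pose u := - (L^-1 *: (A - B)).
have u1 : `|u| = 1 by rewrite normrN normrZ normfV normr_id mulVf // gt_eqF.
pose p (s : R) := B + s *: (A - B).
have pseg s : 0 <= s <= 1 -> segment A B (p s).
  by move=> s01; rewrite segment_sym; apply/segmentP; exists s.
have pE s : 0 <= s -> `|p s - B| = s * L.
  by move=> s0; rewrite /p addrAC subrr add0r normrZ ger0_norm.
pose m (s : R) := s - dist F (p s) / 2 / L.
have mE s : push F u (p s) = p (m s).
  rewrite /push /u scalerN scalerA /p /m -addrA; congr (_ + _).
  by rewrite -scalerBl.
have m01 s : 0 <= s <= 1 -> 0 <= m s <= s.
  move=> /andP[s0 s1]; have := dist_le (p s) FB; rewrite pE // => dF.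
  have := dist_ge0 F (p s) => d0.
  have : dist F (p s) / 2 / L <= s.
    by rewrite ler_pdivrMr //; lra.
  have : 0 <= dist F (p s) / 2 / L by rewrite !divr_ge0 // ltW.
  by rewrite /m; lra.
pose sg := Num.min 1 (r / L / 2).
have sg0 : 0 < sg by rewrite lt_min ltr01 !divr_gt0.
have sg1 : sg <= 1 by rewrite ge_min lexx.
have pcont : continuous p.
  apply: (@lipschitz_continuous _ _ _ L) => s t; rewrite /p.
  rewrite opprD addrACA subrr add0r -scalerBl normrZ mulrC; exact: lexx.
have [|c csg cmin] := @EVT_min _ (fun s => dist F (p s)) sg 1 sg1.
  apply: continuous_subspaceT => s.
  by apply: (@continuous_comp _ _ _ p (dist F)); [exact: pcont|exact: dist_continuous].
move: csg; rewrite in_itv /= => /andP[csg c1].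
have cF0 : 0 < dist F (p c).
  have ps : segment A B (p c) by apply: pseg; rewrite c1 (le_trans (ltW sg0)).
  apply: dist_gt0 => //; first by exists B.
  case=> [nU|/(sK _ ps) pB]; first exact: nU (sU _ ps).
  have := pE c (le_trans (ltW sg0) csg).
  rewrite pB subrr normr0 => /esym/eqP; rewrite mulf_eq0.
  by rewrite (gt_eqF L0) orbF gt_eqF // (lt_le_trans sg0).
pose e := dist F (p c) / 2 / L.
have e0 : 0 < e by rewrite !divr_gt0.
have miter n s : 0 <= s <= 1 ->
    0 <= iter n m s <= 1 /\ (iter n m s <= sg \/ iter n m s <= 1 - n%:R * e).
  move=> s01; elim: n => [|n [i01 IHn]] /=.
    by split=> //; right; rewrite mul0r subr0; case/andP: s01.
  have /andP[i0 ii] := m01 _ i01; split; first lra.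
  have [isg|isg] := leP (iter n m s) sg; first by left; lra.
  right; case: IHn => IHn; first lra.
  have ic : e <= dist F (p (iter n m s)) / 2 / L.
    rewrite /e !ler_pM2r ?invr_gt0 //; apply: cmin; rewrite in_itv /=; lra.
  have -> : m (iter n m s) = iter n m s - dist F (p (iter n m s)) / 2 / L by [].
  by rewrite -[n.+1%:R]natr1 mulrDl mul1r; lra.
pose n := Num.bound (e^-1).
exists (iter n (push F u)); split.
- by apply: homeomorphism_iter; apply: push_homeomorphism; rewrite u1.
- by move=> x Ux; elim: (n) => //= i ->; rewrite push_fix //; left.
- by move=> x Kx; elim: (n) => //= i ->; rewrite push_fix //; right.
move=> x; rewrite segment_sym => /segmentP[s s01 ->]; rewrite -/(p s).
have -> i : iter i (push F u) (p s) = p (iter i m s).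
  by elim: i => //= i ->; rewrite mE.
have [/andP[i0 i1] ism] := miter n s s01.
have isg : iter n m s <= sg.
  case: ism => // ism; have : e^-1 < n%:R.
    have := archi_boundP (ltW (_ : 0 < e^-1)); rewrite invr_gt0 => /(_ e0).
    by [].
  by rewrite -div1r ltr_pdivrMr // => ?; lra.
rewrite pE //; apply: (@le_lt_trans _ _ (r / 2)); last by lra.
rewrite -ler_pdivlMr // mulrAC; apply: (le_trans isg).
by rewrite ge_min lexx orbT.
Qed.

(** A relation, so that the subdivisions of [polygonal] become paths and can be
    cut, reversed and extended as such. *)
Definition straight (g : R -> space) : rel R :=
  [rel a b | (a < b) && `[< g @` `[a, b] = segment (g a) (g b) >]].

Lemma straight_path_lt g a s : path (straight g) a s -> path <%R a s.
Proof. by apply: sub_path => x y /= /andP[]. Qed.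

Lemma path_le_last (a : R) s : path <%R a s -> a <= last a s.
Proof.
elim: s a => //= b s IHs a /andP[ab /IHs]; exact: le_trans (ltW ab).
Qed.

Lemma polygonalP g :
  polygonal g <-> exists2 s, path (straight g) 0 s & last 0 s = 1.
Proof.
split=> [[s [ps ls gs]]|[s ps ls]].
  exists s => //; apply/(pathP 0) => i si /=.
  by apply/andP; split; [exact: (pathP 0 ps)|apply/asboolP; exact: gs].
exists s; split => //; first exact: straight_path_lt ps.
by move=> i si; have /andP[_ /asboolP] := pathP 0 ps i si.
Qed.

(** The arc is shrunk one straight piece at a time from its beginning; a piece
    is squeezed into so small a ball around its end that the homeomorphism
    shrinking the rest of the arc takes the ball along. *)
Lemma shrink_arc U (g : R -> space) a s (r : R) :
  path (straight g) a s -> {within `[a, last a s], continuous g} ->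
  set_inj `[a, last a s] g -> open U -> g @` `[a, last a s] `<=` U -> 0 < r ->
  exists h, [/\ homeomorphism h, forall x, ~ U x -> h x = x &
    forall t, a <= t <= last a s -> `|h (g t) - g (last a s)| < r].
Proof.
move=> + + + oU + r0; elim: s a => [|b s IHs] a /=.
  move=> _ _ _ _; exists id; split=> //; first exact: homeomorphism_id.
  by move=> t t_a; rewrite (le_anti t_a) subrr normr0.
move=> /andP[/andP[ab /asboolP gab] ps] cg ginj gU.
have bl := path_le_last (straight_path_lt ps).
have bal : `[b, last b s] `<=` `[a, last b s].
  by apply: subset_itvr; rewrite bnd_simp ltW.
have abl : `[a, b] `<=` `[a, last b s] by apply: subset_itvl; rewrite bnd_simp.
have cgb : {within `[b, last b s], continuous g} by exact: continuous_subspaceW cg.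
have [|h [hh hU hs]] := IHs b ps cgb _ (subset_trans (image_subset g bal) gU).
  by apply: sub_in2 ginj => x; rewrite !inE => /bal.
have bb : `[b, last b s]%classic b by rewrite /= in_itv /= lexx.
have [e e0 he] : exists2 e : R, 0 < e & forall x, `|x - g b| < e ->
    `|h x - g (last b s)| < r.
  have : nbhs (h (g b)) (ball (g (last b s)) r).
    apply: open_nbhs_nbhs; split; first exact: ball_open.
    by rewrite -ball_normE /= distrC; apply: hs; rewrite lexx.
  move=> /(hh.1 (g b)) /nbhs_ballP[e /= e0 he]; exists e => // x xe.
  have := he x; rewrite -!ball_normE /= distrC => /(_ xe); by rewrite distrC.
have [||||h1 [hh1 h1U h1K h1s]] :=
    @shrink_segment U (g @` `[b, last b s]) (g a) (g b) e oU _ _ _ _ e0.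
- apply: compact_closed; first exact: norm_hausdorff.
  by apply: continuous_compact => //; exact: segment_compact.
- by exists b.
- by rewrite -gab; apply: subset_trans gU; exact: image_subset.
- move=> x; rewrite -gab => -[t tab <-] [t' tbl gtt].
  congr (g _); have tt : t' = t.
    by apply: ginj => //; rewrite inE; [exact: bal|exact: abl].
  apply/le_anti; move: tab tbl; rewrite tt /= !in_itv /= => /andP[_ ->].
  by case/andP.
exists (h \o h1); split.
- exact: homeomorphism_comp.
- by move=> x Ux /=; rewrite h1U // hU.
move=> t /andP[t_a tl] /=; have [tb|bt] := leP t b.
  by apply/he/h1s; rewrite -gab; exists t => //=; rewrite in_itv /= t_a.
have tbl : b <= t <= last b s by rewrite (ltW bt).
by rewrite h1K; [exact: hs|exists t => //=; rewrite in_itv].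
Qed.

End Shrinking.

(** * Sets separated by spheres *)

Section Separation.
Variable R : realType.
Notation space := 'rV[R]_3.
Implicit Types (h : space -> space) (P Q S K : set space) (x y u : space).

(** The splitting relation for arbitrary sets: unlike links, these can be
    transported, enlarged and perturbed. *)
Definition split_apart P Q : Prop :=
  exists S, [/\ embedded_sphere S, P `&` S = set0, Q `&` S = set0 &
    forall x y, P x -> Q y -> ~ connected_component (~` S) x y].

Lemma split_apart_sub P P' Q Q' :
  P' `<=` P -> Q' `<=` Q -> split_apart P Q -> split_apart P' Q'.
Proof.
move=> sP sQ [S [eS PS QS sepS]]; exists S; split=> //.
- by rewrite -subset0 -PS => x [/sP].
- by rewrite -subset0 -QS => x [/sQ].
by move=> x y /sP Px /sQ Qy; exact: sepS.
Qed.

Lemma embedded_sphere_homeomorphism h S :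
  homeomorphism h -> embedded_sphere S -> embedded_sphere (h @` S).
Proof.
move=> [ch [k [_ hK _]]] [g [cg ginj ->]]; exists (h \o g); split.
- exact: within_continuous_comp.
- move=> x y xS yS /= /(can_inj hK); exact: ginj.
- by rewrite image_comp.
Qed.

Lemma split_apart_homeomorphism h P Q :
  homeomorphism h -> split_apart P Q -> split_apart (h @` P) (h @` Q).
Proof.
move=> hh [S [eS PS QS sepS]]; exists (h @` S); split.
- exact: embedded_sphere_homeomorphism.
- have [_ [k [_ hK _]]] := hh.
  rewrite -subset0 => _ [[x Px <-] [y Sy /(can_inj hK) yx]].
  have : (P `&` S) x by split=> //; rewrite -yx.
  by rewrite PS.
- have [_ [k [_ hK _]]] := hh.
  rewrite -subset0 => _ [[x Px <-] [y Sy /(can_inj hK) yx]].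
  have : (Q `&` S) x by split=> //; rewrite -yx.
  by rewrite QS.
have [_ [k [ck hK kK]]] := hh.
move=> _ _ [x Px <-] [y Qy <-] [C [Chx CS cC] Chy].
apply: (sepS x y Px Qy); exists (k @` C); last by exists (h y); rewrite ?hK.
split; first by exists (h x); rewrite ?hK.
- move=> _ [z Cz <-] Skz; apply: (CS z Cz); exists (k z) => //; exact: kK.
- by apply: connected_continuous_connected => //; exact: continuous_subspaceT.
Qed.

Lemma coord_le_norm x i : `|x 0 i| <= `|x|.
Proof.
have -> : `|x| = mx_norm x by [].
rewrite mx_normrE.
by apply/bigmax_geP; right => /=; exists (0, i).
Qed.

Lemma norm_le_coord x (c : R) : 0 <= c -> (forall i, `|x 0 i| <= c) -> `|x| <= c.
Proof.
move=> c0 xc; have -> : `|x| = mx_norm x by [].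
rewrite mx_normrE.
by apply: bigmax_le => // -[i j] _ /=; rewrite (ord1 i).
Qed.

Definition sqr_norm x : R := \sum_i x 0 i ^+ 2.

Lemma sqr_normE x : sqr_norm x = x 0 0 ^+ 2 + x 0 1 ^+ 2 + x 0 2%:R ^+ 2.
Proof.
rewrite /sqr_norm !big_ord_recl big_ord0 addr0 addrA.
by congr (_ + _ ^+ 2 + _ ^+ 2); congr (x 0 _); apply: val_inj.
Qed.

Lemma sqr_norm_continuous : continuous sqr_norm.
Proof.
have -> : sqr_norm = fun x => x 0 0 * x 0 0 + x 0 1 * x 0 1 + x 0 2%:R * x 0 2%:R.
  by apply/funext => x; rewrite sqr_normE !expr2.
move=> x; have cc i : continuous (fun x : space => x 0 i) by exact: coord_continuous.
have cc2 i : continuous (fun x : space => x 0 i * x 0 i).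
  by move=> y; exact: (cvgM (cc i y) (cc i y)).
exact: (cvgD (cvgD (cc2 0 x) (cc2 1 x)) (cc2 2%:R x)).
Qed.

Lemma sqr_normZ (a : R) x : sqr_norm (a *: x) = a ^+ 2 * sqr_norm x.
Proof. by rewrite !sqr_normE !mxE; ring. Qed.

Lemma sqr_norm_le (c : R) x : 0 <= c -> sqr_norm x <= c ^+ 2 -> `|x| <= c.
Proof.
move=> c0 xc; apply: norm_le_coord => // i.
rewrite -(@ler_pXn2r _ 2) ?nnegrE // real_normK ?num_real //.
apply: le_trans xc; rewrite /sqr_norm (bigD1 i) //= lerDl.
by apply: sumr_ge0 => j _; exact: sqr_ge0.
Qed.

Lemma sqr_norm_lt (c : R) x : 0 < c -> `|x| < c -> sqr_norm x < (2 * c) ^+ 2.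
Proof.
move=> c0 xc; rewrite sqr_normE.
have sq i : x 0 i ^+ 2 < c ^+ 2.
  rewrite -real_normK ?num_real //.
  have := normr_ge0 (x 0 i); have := coord_le_norm x i.
  by move: xc; set a := `|x 0 i|; set b := `|x|; nra.
have := sq 0; have := sq 1; have := sq 2%:R; rewrite exprMn; nra.
Qed.

Lemma unit_sphere_compact : compact (unit_sphere (R := R)).
Proof.
apply: bounded_closed_compact.
  exists 1; split; first exact: num_real.
  move=> c c1 x /= xS; apply: (le_trans _ (ltW c1)).
  by apply: sqr_norm_le => //; rewrite expr1n /sqr_norm xS.
have -> : unit_sphere (R := R) = sqr_norm @^-1` [set 1] by [].
apply: preimage_closed; last exact: closed_eq.
by move=> x _; exact: sqr_norm_continuous.
Qed.

Lemma embedded_sphere_closed S : embedded_sphere S -> closed S.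
Proof.
move=> [g [cg _ ->]]; apply: compact_closed; first exact: norm_hausdorff.
by apply: continuous_compact => //; exact: unit_sphere_compact.
Qed.

Lemma embedded_sphere_nonempty S : embedded_sphere S -> S !=set0.
Proof.
move=> [g [_ _ ->]]; exists (g (\row_i (i == 0)%:R)).
exists (\row_i (i == 0)%:R) => //.
by rewrite /unit_sphere /= -/(sqr_norm _) sqr_normE !mxE /=; ring.
Qed.

Lemma compact_dist_gt0 P S : compact P -> S !=set0 -> closed S ->
  P `&` S = set0 -> exists2 d : R, 0 < d & forall x, P x -> d <= dist S x.
Proof.
move=> cP S0 cS PS; have [->|/set0P P0] := eqVneq P set0.
  by exists 1.
have [|c cinP cmin] := EVT_min_rV P0 cP (f := dist S).
  by apply: continuous_subspaceT; exact: dist_continuous.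
exists (dist S c); last by move=> x Px; apply: cmin; rewrite inE.
apply: dist_gt0 => // Sc; have : set0 c by rewrite -PS; split; rewrite ?inE in cinP.
by [].
Qed.

Lemma segment_connected_set x y : connected (segment x y).
Proof.
apply: connected_continuous_connected; first exact: segment_connected.
apply: continuous_subspaceT.
apply: (@lipschitz_continuous _ _ _ `|y - x|) => s t.
by rewrite opprD addrACA subrr add0r -scalerBl normrZ mulrC.
Qed.

Lemma connected_component_near S (x y : space) :
  `|x - y| < dist S x -> connected_component (~` S) x y.
Proof.
move=> xy; exists (segment x y); last exact: segment_right.
split; [exact: segment_left| |exact: segment_connected_set].
move=> z /segmentP[s s01 zE] /(@dist_le _ _ x); rewrite leNgt => /negP; apply.
apply: le_lt_trans xy; rewrite zE opprD addNKr normrN normrZ distrC.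
by rewrite ger0_norm; [apply: ler_piMl => //|]; case/andP: s01.
Qed.

Definition near_set (d : R) P P' := forall x', P' x' -> exists2 x, P x & `|x - x'| < d.

(** A separating sphere keeps a positive distance from the compact sets that it
    separates, so it goes on separating whatever stays close to them. *)
Lemma split_apart_near P Q : compact P -> compact Q -> split_apart P Q ->
  exists2 d : R, 0 < d &
    forall P' Q', near_set d P P' -> near_set d Q Q' -> split_apart P' Q'.
Proof.
move=> cP cQ [S [eS PS QS sepS]].
have S0 := embedded_sphere_nonempty eS; have cS := embedded_sphere_closed eS.
have [d1 d10 Pd] := compact_dist_gt0 cP S0 cS PS.
have [d2 d20 Qd] := compact_dist_gt0 cQ S0 cS QS.
exists (Num.min d1 d2); first by rewrite lt_min d10.
move=> P' Q' PP' QQ'.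
have linkP x' : P' x' -> exists2 x, P x & connected_component (~` S) x x'.
  move=> /PP'[x Px]; rewrite lt_min => /andP[xx' _]; exists x => //.
  exact/connected_component_near/(lt_le_trans xx')/Pd.
have linkQ x' : Q' x' -> exists2 x, Q x & connected_component (~` S) x x'.
  move=> /QQ'[x Px]; rewrite lt_min => /andP[_ xx']; exists x => //.
  exact/connected_component_near/(lt_le_trans xx')/Qd.
exists S; split=> //.
- rewrite -subset0 => x' [/linkP[x _ /connected_component_sub Sx'] Sx].
  exact: Sx'.
- rewrite -subset0 => x' [/linkQ[x _ /connected_component_sub Sx'] Sx].
  exact: Sx'.
move=> x' y' /linkP[x Px xx'] /linkQ[y Qy yy'] x'y'; apply: (sepS x y Px Qy).
apply: connected_component_trans xx' _.
by apply: connected_component_trans x'y' _; exact: connected_component_sym.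
Qed.

(** Once the arc has been shrunk into a small round ball, without moving [K], the
    sphere bounding a larger ball can be carried back. *)
Lemma split_apart_arc K (g : R -> space) : polygonal g ->
  {within `[0, 1], continuous g} -> set_inj `[0, 1] g -> closed K ->
  (g @` `[0, 1]) `&` K = set0 -> split_apart (g @` `[0, 1]) K.
Proof.
move=> /polygonalP[s ps ls] cg ginj cK gK.
have oU := closed_openC cK; set p := g 1.
have gU : g @` `[0, 1] `<=` ~` K.
  by move=> x gx Kx; have : set0 x by rewrite -gK.
have : nbhs p (~` K).
  apply: open_nbhs_nbhs; split=> //; apply: gU.
  by exists 1; rewrite //= in_itv /= ler01 lexx.
move=> /nbhs_ballP[d /= d0 dK].
pose r := d / 4; have r0 : 0 < r by rewrite divr_gt0.
have [|||h [hh hU hg]] := shrink_arc ps _ _ oU _ r0; rewrite ?ls //.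
have [ch [k [ck hK kK]]] := hh; rewrite ls -/p in hg.
pose N x := sqr_norm (h x - p).
have cN : continuous N.
  move=> x; apply: (@continuous_comp _ _ _ (fun x => h x - p) sqr_norm).
    exact: (cvgB (ch x) (cvg_cst p)).
  exact: sqr_norm_continuous.
pose S := [set x | N x = (2 * r) ^+ 2].
have Nin x : (g @` `[0, 1]) x -> N x < (2 * r) ^+ 2.
  by move=> [t /= + <-]; rewrite in_itv => t01; apply: sqr_norm_lt => //; exact: hg.
have Nout x : K x -> (2 * r) ^+ 2 < N x.
  move=> Kx; rewrite ltNge; apply/negP => Nx; apply: (dK x) => //.
  rewrite -ball_normE /= distrC.
  have r2 : 0 <= 2 * r by lra.
  by have := sqr_norm_le r2 Nx; rewrite hU // /r; lra.
exists S; split.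
- pose e u := k (p + (2 * r) *: u).
  have r2 : 2 * r != 0 by rewrite mulf_neq0 // gt_eqF.
  exists e; split.
  + apply: continuous_subspaceT => u.
    apply: (@continuous_comp _ _ _ (fun u => p + (2 * r) *: u) k); last exact: ck.
    apply: (@lipschitz_continuous _ _ _ `|2 * r|) => v w.
    by rewrite opprD addrACA subrr add0r -scalerBr normrZ.
  + by move=> u v _ _ /(can_inj kK) /addrI /(scalerI r2).
  apply/seteqP; split=> [x Sx|_ [u uS <-]].
    exists ((2 * r)^-1 *: (h x - p)); last first.
      by rewrite /e scalerA divff // scale1r addrC subrK hK.
    rewrite /unit_sphere /= -/(sqr_norm _) sqr_normZ.
    by move: Sx; rewrite /S /= /N => ->; rewrite exprVn mulVf // expf_neq0.
  rewrite /S /= /N kK addrAC subrr add0r sqr_normZ.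
  by move: uS; rewrite /unit_sphere /= -/(sqr_norm _) => ->; rewrite mulr1.
- by rewrite -subset0 => x [/Nin + Sx]; rewrite Sx ltxx.
- by rewrite -subset0 => x [/Nout + Sx]; rewrite Sx ltxx.
move=> x y /Nin Nx /Nout Ny [C [Cx CS cC] Cy].
have /connected_intervalP iNC : connected (N @` C).
  by apply: connected_continuous_connected => //; exact: continuous_subspaceT.
have [|||z Cz Nz] := iNC (N x) (N y) _ _ ((2 * r) ^+ 2) _.
- by exists x.
- by exists y.
- by rewrite (ltW Nx) ltW.
exact: CS Cz Nz.
Qed.

End Separation.

(** * Pushing polygonal arcs off themselves *)

Section Parallel.
Variable R : realType.
Notation space := 'rV[R]_3.
Implicit Types (g : R -> space) (x y u v w : space).

Lemma common_radius (T : eqType) (s : seq T) (P : T -> R -> Prop) :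
  (forall i r r', r' <= r -> P i r -> P i r') ->
  (forall i, i \in s -> exists2 r, 0 < r & P i r) ->
  exists2 r, 0 < r & forall i, i \in s -> P i r.
Proof.
move=> Pdown; elim: s => [|i s IHs] Ps; first by exists 1.
have [|r r0 Pr] := IHs; first by move=> j js; apply: Ps; rewrite inE js orbT.
have [|r' r'0 Pr'] := Ps i; first by rewrite inE eqxx.
exists (Num.min r r'); first by rewrite lt_min r0.
move=> j; rewrite inE => /orP[/eqP->|/Pr].
  by move: Pr'; apply: Pdown; rewrite ge_min lexx orbT.
by apply: Pdown; rewrite ge_min lexx.
Qed.

Definition dot u v : R := (u *m v^T) 0 0.

Lemma dotE u v : dot u v = \sum_i u 0 i * v 0 i.
Proof. by rewrite /dot mxE; apply: eq_bigr => i _; rewrite mxE. Qed.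

Lemma dotB n u v : dot n (u - v) = dot n u - dot n v.
Proof. by rewrite /dot linearB mulmxBr !mxE. Qed.

Lemma dotD n u v : dot n (u + v) = dot n u + dot n v.
Proof. by rewrite /dot linearD mulmxDr !mxE. Qed.

Lemma dotZ n (c : R) u : dot n (c *: u) = c * dot n u.
Proof. by rewrite /dot linearZ -scalemxAr mxE. Qed.

Lemma common_normal u v : exists n, [/\ n != 0, dot n u = 0 & dot n v = 0].
Proof.
pose M : 'M[R]_(3, 1 + 1) := row_mx u^T v^T.
have [n n0 nM] : exists2 n : space, n != 0 & n *m M = 0.
  exists (nz_row (kermx M)).
    rewrite nz_row_eq0 kermx_eq0 /row_free; apply/eqP => r3.
    by have := rank_leq_col M; rewrite r3.
  by apply/eqP; rewrite -sub_kermx; exact: nz_row_sub.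
exists n; move/eqP: nM; rewrite mul_mx_row row_mx_eq0 => /andP[/eqP nu /eqP nv].
by split; rewrite // /dot ?nu ?nv mxE.
Qed.

(** Points of the moment curve do the job, as each plane through the origin
    contains at most two of them. *)
Lemma generic_direction (ns : seq space) : all (fun n : space => n != 0) ns ->
  exists w, all (fun n => dot n w != 0) ns.
Proof.
move=> ns0; pose p (n : space) : {poly R} := \poly_(i < 3) n 0 (inord i).
have p0 (n : space) : n != 0 -> p n != 0.
  apply: contraNneq => pn; apply/eqP/rowP => i; rewrite mxE.
  by have := coef_poly 3 (fun i => n 0 (inord i)) i;
    rewrite -/(p n) pn coef0 ltn_ord inord_val.
pose q := \prod_(n <- ns) p n.
have q0 : q != 0.
  by rewrite prodf_seq_neq0; apply/allP => n /(allP ns0); exact: p0.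
have [c qc] : exists c : R, q.[c] != 0.
  apply: contrapT => noc.
  pose rs : seq R := [seq i%:R | i <- iota 0 (size q)].
  have := @max_poly_roots _ q rs q0; rewrite size_map size_iota ltnn.
  move=> /(_ _ _) H; apply: notF; apply: H.
    apply/allP => x _; apply/rootP/eqP; apply: contrapT => /negP qx.
    by apply: noc; exists x.
  by rewrite map_inj_uniq ?iota_uniq // => i j /eqP; rewrite eqr_nat => /eqP.
exists (\row_i c ^+ i); apply/allP => n ns_n.
have : (p n).[c] != 0.
  apply: contraNneq qc => pc; rewrite /q horner_prod; apply/eqP.
  by rewrite (big_rem n ns_n) /= pc mul0r.
rewrite horner_poly dotE; congr (_ != 0); apply: eq_bigr => i _.
by rewrite inord_val mxE.
Qed.

(** If [w] is not in the plane spanned by the directions of two segments, then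
    at most one multiple of [w] leads from a point of one to a point of the
    other.  Being finitely many, these multiples leave room for small ones. *)
Lemma transverse_direction (l : seq (space * space)) :
  exists w, exists2 r : R, 0 < r & forall p q x y (c : R), p \in l -> q \in l ->
    segment p.1 p.2 x -> segment q.1 q.2 y -> `|c| <= r -> x - y = c *: w -> c = 0.
Proof.
pose n p := projT1 (cid (common_normal (p.1.2 - p.1.1) (p.2.2 - p.2.1))).
have nP p : [/\ n p != 0, dot (n p) (p.1.2 - p.1.1) = 0 &
    dot (n p) (p.2.2 - p.2.1) = 0] by rewrite /n; case: cid.
pose ll := [seq (p, q) | p <- l, q <- l].
have [|w wn] := @generic_direction [seq n p | p <- ll].
  by apply/allP => _ /mapP[p _ ->]; case: (nP p).
exists w.
have [||r r0 Pr] := @common_radius _ ll (fun p r => forall x y (c : R),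
  segment p.1.1 p.1.2 x -> segment p.2.1 p.2.2 y -> `|c| <= r ->
  x - y = c *: w -> c = 0).
- move=> p r r' rr' Pr x y c px qy cr'; apply: Pr => //; exact: le_trans cr' rr'.
- move=> p pl; have [_ np nq] := nP p.
  have nw : dot (n p) w != 0 by apply: (allP wn); exact: map_f.
  pose k := dot (n p) (p.1.1 - p.2.1).
  have kE x y c : segment p.1.1 p.1.2 x -> segment p.2.1 p.2.2 y ->
      x - y = c *: w -> k = c * dot (n p) w.
    move=> /segmentP[s _ ->] /segmentP[s' _ ->] /(congr1 (dot (n p))).
    by rewrite dotZ opprD addrACA dotD -/k dotB !dotZ np nq !mulr0 subr0 addr0.
  have [k0|k0] := eqVneq k 0.
    exists 1 => // x y c px qy _ /(kE _ _ _ px qy) /esym/eqP.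
    by rewrite k0 mulf_eq0 (negbTE nw) orbF => /eqP.
  exists (`|k| / `|dot (n p) w| / 2); first by rewrite !divr_gt0 ?normr_gt0.
  move=> x y c px qy cr /(kE _ _ _ px qy) kc.
  have c0 : c != 0 by apply: contraNneq k0 => c0; rewrite kc c0 mul0r.
  have : 0 < `|c| by rewrite normr_gt0.
  by move: cr; rewrite kc normrM mulfK ?normr_eq0 //; lra.
exists r => // p q x y c pl ql px qy; apply: (Pr (p, q)) => //.
by apply/allpairsP; exists (p, q).
Qed.

Lemma polygonal_cover g : polygonal g -> exists l : seq (space * space),
  forall t, 0 <= t <= 1 -> exists2 p, p \in l & segment p.1 p.2 (g t).
Proof.
move=> /polygonalP[s + <-]; move: (0 : R) => a; elim: s a => [|b s IHs] a /=.
  move=> _; exists [:: (g a, g a)] => t /le_anti <-.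
  by exists (g a, g a); rewrite ?mem_head //; exact: segment_left.
move=> /andP[/andP[ab /asboolP gab] /IHs[l lP]]; exists ((g a, g b) :: l).
move=> t /andP[ta tl]; have [tb|bt] := leP t b.
  exists (g a, g b); first exact: mem_head.
  by rewrite /= -gab; exists t => //=; rewrite in_itv /= ta.
have [|p pl pt] := lP t; first by rewrite (ltW bt).
by exists p; rewrite // inE pl orbT.
Qed.

Lemma straight_rev g (a b : R) :
  straight g a b -> straight (fun t => g (1 - t)) (1 - b) (1 - a).
Proof.
move=> /andP[ab /asboolP gab]; apply/andP; split; first lra.
apply/asboolP; rewrite !subKr segment_sym -gab; apply/seteqP; split=> x /=.
  move=> [t]; rewrite in_itv /= => /andP[t1 t2] <-.
  by exists (1 - t) => //; rewrite in_itv /=; lra.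
move=> [t]; rewrite in_itv /= => /andP[t1 t2] <-.
by exists (1 - t); rewrite ?subKr // in_itv /=; lra.
Qed.

Lemma polygonal_rev g : polygonal g -> polygonal (fun t => g (1 - t)).
Proof.
move=> /polygonalP[s ps ls]; apply/polygonalP.
exists [seq 1 - t | t <- rev (belast 0 s)].
  have : path (relpre (fun t => 1 - t) (straight (fun t => g (1 - t))))
      (last 0 s) (rev (belast 0 s)).
    by rewrite rev_path; apply: sub_path ps => a b /=; exact: straight_rev.
  by rewrite -path_map ls subrr.
case: s ls {ps} => [/= /esym/eqP|a s _]; first by rewrite oner_eq0.
by rewrite /= rev_cons map_rcons last_rcons subr0.
Qed.

Lemma min_continuous (a : R) : continuous (fun t : R => Num.min t a).
Proof.
apply: (@lipschitz_continuous _ _ _ 1) => s t; rewrite mul1r ler_norml.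
by case: (leP s a); case: (leP t a); case: (ger0P (s - t)) => *; lra.
Qed.

Lemma max_continuous (a : R) : continuous (fun t : R => Num.max t a).
Proof.
apply: (@lipschitz_continuous _ _ _ 1) => s t; rewrite mul1r ler_norml.
by case: (leP s a); case: (leP t a); case: (ger0P (s - t)) => *; lra.
Qed.

Definition clamp (t : R) := Num.max (Num.min t 1) 0.

Lemma clamp01 t : 0 <= clamp t <= 1.
Proof.
by rewrite /clamp le_max lexx orbT ge_max ler01 ge_min lexx orbT.
Qed.

Lemma clamp_id t : 0 <= t <= 1 -> clamp t = t.
Proof. by move=> /andP[t0 t1]; rewrite /clamp min_l // max_l. Qed.

Lemma continuous_clamp g : {within `[0, 1], continuous g} ->
  continuous (g \o clamp).
Proof.
move=> cg t; have ct : `[0, 1]%classic (clamp t) by rewrite /= in_itv; exact: clamp01.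
have cc : {for t, continuous clamp}.
  have := @continuous_comp _ _ _ (fun t : R => Num.min t 1) (fun t => Num.max t 0) t.
  by apply; [exact: min_continuous|exact: max_continuous].
move=> A nA.
have wA : within `[0, 1]%classic (nbhs (clamp t)) (g @^-1` A).
  by rewrite (nbhs_subspace_in ct); exact: (cg (clamp t) A nA).
have clA : nbhs t (clamp @^-1` [set s | `[0, 1]%classic s -> A (g s)]) := cc _ wA.
change (nbhs t ((g \o clamp) @^-1` A)); apply: filterS clA => s /=; apply.
by rewrite in_itv; exact: clamp01.
Qed.

Lemma within_clamp g g' : continuous g' -> (forall t, 0 <= t <= 1 -> g' t = g t) ->
  {within `[0, 1], continuous g}.
Proof.
move=> cg' gg'; apply: (@subspace_eq_continuous _ _ _ g').
  by move=> t /set_mem; rewrite /= in_itv; exact: gg'.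
exact: continuous_subspaceT.
Qed.

End Parallel.

Section Tent.
Variable R : realType.
Notation space := 'rV[R]_3.
Implicit Types (g : R -> space) (x y u v w : space).

Lemma straight_left g (a b c : R) : straight g a b -> a < c < b ->
  {within `[a, b], continuous g} -> set_inj `[a, b] g -> straight g a c.
Proof.
move=> /andP[ab /asboolP gab] /andP[ac cb] cg ginj.
have inab t : a <= t <= b -> `[a, b]%classic t by rewrite /= in_itv.
have [i D0] : exists i, (g b - g a) 0 i != 0.
  apply: contrapT => noi; have gE : g b = g a.
    apply/eqP; rewrite -subr_eq0; apply/eqP/rowP => i; rewrite [RHS]mxE.
    by apply/eqP; apply: contrapT => /negP ?; apply: noi; exists i.
  have : a = b by apply: ginj; rewrite ?inE ?gE //; apply: inab; rewrite ?lexx ltW.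
  by move: ab => /[swap] ->; rewrite ltxx.
pose D := g b - g a; pose s t := (g t - g a) 0 i / D 0 i.
have gE t : a <= t <= b -> 0 <= s t <= 1 /\ g t = g a + s t *: D.
  move=> tab; have : segment (g a) (g b) (g t) by rewrite -gab; exists t => //; exact: inab.
  move=> /segmentP[r r01 rE]; suff -> : s t = r by [].
  by rewrite /s rE addrAC subrr add0r mxE mulfK.
have sE (x t : R) : a <= t <= b -> a <= x <= b -> s x = s t -> x = t.
  move=> tab xab sxt; apply: ginj; rewrite ?inE; [exact: inab|exact: inab|].
  by rewrite (gE _ tab).2 (gE _ xab).2 sxt.
have cs : {within `[a, b], continuous s}.
  pose c_ x := (x - g a) 0 i / D 0 i; have ci : continuous c_.
    apply: (@lipschitz_continuous _ _ _ `|(D 0 i)^-1|) => x y.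
    rewrite -mulrBl normrM mulrC; apply: ler_wpM2l => //.
    by apply: le_trans (coord_le_norm _ i); rewrite !mxE opprD addrACA subrr addr0.
  exact: (within_continuous_comp cg ci).
have sa : s a = 0 by rewrite /s subrr mxE mul0r.
have ivt t r : a <= t <= b -> 0 <= r <= s t -> exists2 x, a <= x <= t & s x = r.
  move=> /andP[ta tb] /andP[r0 rt].
  have [||x] := @IVT _ s a t r ta.
  - apply: continuous_subspaceW cs => y; rewrite /= !in_itv /= => /andP[-> yt].
    exact: le_trans yt tb.
  - by rewrite sa ge_min r0 le_max rt orbT.
  by rewrite in_itv /=; exists x.
have cab : a <= c <= b by rewrite !ltW.
have sc0 : 0 < s c.
  rewrite lt_neqAle; have [/andP[-> _] _] := gE c cab; rewrite andbT eq_sym.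
  apply/eqP => sc; have := sE c a; rewrite lexx (ltW ab) cab sc sa => /(_ _ _ _) ca.
  by move: ac; rewrite ca // ltxx.
have smono t : a <= t <= c -> s t <= s c.
  move=> /andP[ta tc]; rewrite leNgt; apply/negP => sct.
  have tab : a <= t <= b by rewrite ta (le_trans tc) // ltW.
  have [|x /andP[ax xt] sx] := ivt t (s c) tab; first by rewrite !ltW.
  have xc : x = c by apply: sE => //; rewrite ax (le_trans xt) // (andP tab).2.
  have tcE : t = c by apply/le_anti; rewrite tc -xc xt.
  by move: sct; rewrite tcE ltxx.
apply/andP; split=> //; apply/asboolP/seteqP; split=> x.
  move=> [t /=]; rewrite in_itv /= => tac <-.
  have [/andP[ta tc] tab] : a <= t <= c /\ a <= t <= b.
    by move: tac => /andP[-> tc]; split=> //=; rewrite (le_trans tc) // ltW.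
  apply/segmentP; exists (s t / s c).
    have [/andP[st0 _] _] := gE t tab.
    rewrite ler_pdivrMr // mul1r smono ?ta // andbT.
    by rewrite divr_ge0 // ltW.
  by rewrite (gE t tab).2 (gE c cab).2 [g a + s c *: D - g a]addrAC subrr add0r
    scalerA divfK // gt_eqF.
move=> /segmentP[r /andP[r0 r1] ->]; rewrite (gE c cab).2.
have [|t tac st] := ivt c (r * s c) cab.
  by rewrite mulr_ge0 ?(ltW sc0) //= ler_piMl // ltW.
exists t; first by rewrite /= in_itv.
have tab : a <= t <= b.
  by move: tac => /andP[-> tc]; rewrite (le_trans tc) // ltW.
by rewrite (gE t tab).2 st [g a + s c *: D - g a]addrAC subrr add0r scalerA.
Qed.

Lemma within_rev g : {within `[0, 1], continuous g} ->
  {within `[0, 1], continuous (fun t => g (1 - t))}.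
Proof.
move=> /continuous_clamp cg.
apply: (@within_clamp _ _ (fun t => (g \o @clamp R) (1 - t))).
  move=> t; have := @continuous_comp _ _ _ (fun t : R => 1 - t) (g \o @clamp R) t.
  apply; last exact: cg.
  apply: (@lipschitz_continuous _ _ _ 1) => a b.
  by rewrite mul1r distrC; have -> : 1 - b - (1 - a) = a - b by ring.
by move=> t t01 /=; rewrite clamp_id //; lra.
Qed.

Lemma straight_right g (c : R) : straight g 0 1 -> 0 < c < 1 ->
  {within `[0, 1], continuous g} -> set_inj `[0, 1] g -> straight g c 1.
Proof.
move=> g01 c01 cg ginj.
have g'01 := straight_rev g01; rewrite subr0 subrr in g'01.
have : straight (fun t => g (1 - t)) 0 (1 - c).
  apply: (straight_left g'01); [lra|exact: within_rev|].
  move=> s t; rewrite !inE /= !in_itv /= => s01 t01 st.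
  have : 1 - s = 1 - t by apply: ginj => //; rewrite inE /= in_itv /=; lra.
  by lra.
move=> /straight_rev; rewrite subKr subr0.
by congr (is_true (straight _ c 1)); apply/funext => t; rewrite subKr.
Qed.

(** Cutting off a first and a last piece, which must be different pieces even
    when the whole arc is straight. *)
Lemma polygonal_ends g : polygonal g -> {within `[0, 1], continuous g} ->
  {in `]0, 1[ &, injective g} ->
  (forall t, 0 < t < 1 -> g t <> g 0 /\ g t <> g 1) ->
  exists a b m, [/\ 0 < a, a <= b, b < 1, straight g 0 a &
    [/\ path (straight g) a m, last a m = b & straight g b 1]].
Proof.
move=> /polygonalP[s ps ls] cg ginj gends.
have one0 : (0 : R) = 1 -> False by move/esym/eqP; rewrite oner_eq0.
case: s ps ls => [|a s] //= /andP[ga ps] ls.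
case/lastP: s ps ls => [_ /= a1|m b].
  rewrite a1 in ga.
  have g01 : g 0 <> g 1.
    move=> g01; have : segment (g 0) (g 1) (g 2^-1).
      move: ga => /andP[_ /asboolP <-]; exists 2^-1 => //; rewrite /= in_itv /=; lra.
    move=> /segmentP[r _]; rewrite g01 subrr scaler0 addr0 => g2.
    by case: (gends 2^-1); [lra|].
  have ginj01 : set_inj `[0, 1] g.
    move=> s t; rewrite !inE /= !in_itv /=.
    move=> /andP[]; rewrite le_eqVlt => /predU1P[<- _|s0].
      move=> /andP[]; rewrite le_eqVlt => /predU1P[//|t0].
      rewrite le_eqVlt => /predU1P[->//|t1] /esym.
      by case: (gends t); rewrite ?t0.
    rewrite le_eqVlt => /predU1P[->|s1].
      move=> /andP[]; rewrite le_eqVlt => /predU1P[<- _ /esym//|t0].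
      rewrite le_eqVlt => /predU1P[->//|t1] /esym.
      by case: (gends t); rewrite ?t0.
    have [s_0 s_1] : g s <> g 0 /\ g s <> g 1 by apply: gends; rewrite s0.
    move=> /andP[]; rewrite le_eqVlt => /predU1P[<- //|t0].
    rewrite le_eqVlt => /predU1P[->//|t1] gst.
    by apply: ginj => //; rewrite in_itv /= ?s0 ?t0.
  exists 2^-1, 2^-1, [::]; split=> //; [lra|lra| |].
    by apply: (straight_left ga) => //; lra.
  by split=> //; apply: straight_right => //; lra.
rewrite rcons_path last_rcons => /andP[pm gb] b1; rewrite b1 in gb.
exists a, (last a m), m; split=> //; last by case/andP: gb.
  by case/andP: ga.
exact/path_le_last/straight_path_lt/pm.
Qed.

Lemma path_mem_le (a b : R) m : path <%R a m -> last a m = b ->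
  {in a :: m, forall t, a <= t <= b}.
Proof.
elim: m a => [|c m IHm] a /=.
  by move=> _ <- t; rewrite inE => /eqP->; rewrite lexx.
move=> /andP[ac pm] lm t; rewrite inE => /predU1P[->|tm].
  by rewrite lexx -lm (le_trans (ltW ac)) // path_le_last.
by have /andP[ct ->] := IHm c pm lm t tm; rewrite (le_trans (ltW ac)).
Qed.

Lemma straight_shear g (l : R -> R) v (a b : R) : straight g a b ->
  (forall t s, a <= t <= b -> 0 <= s <= 1 -> g t = g a + s *: (g b - g a) ->
    l t = l a + s * (l b - l a)) ->
  straight (fun t => g t + l t *: v) a b.
Proof.
move=> /andP[ab /asboolP gab] lE; apply/andP; split=> //; apply/asboolP.
have shear s : g a + s *: (g b - g a) + (l a + s * (l b - l a)) *: v =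
    g a + l a *: v + s *: (g b + l b *: v - (g a + l a *: v)).
  by apply/rowP => i; rewrite !mxE; ring.
apply/seteqP; split=> x.
  move=> [t /= tab <-]; rewrite in_itv /= in tab.
  have : segment (g a) (g b) (g t) by rewrite -gab; exists t.
  move=> /segmentP[s s01 gt]; apply/segmentP; exists s => //.
  by rewrite (lE t s tab s01 gt) gt shear.
move=> /segmentP[s s01 ->].
have : segment (g a) (g b) (g a + s *: (g b - g a)) by apply/segmentP; exists s.
rewrite -gab => -[t /= tab gt]; exists t => //; rewrite in_itv /= in tab.
by rewrite (lE t s tab s01 gt) gt shear.
Qed.

(** The profile along which the arc is lifted off itself: it rises linearly on
    the first straight piece and falls on the last one, so that all lifts
    [g + l v] are polygonal with the same ends. *)
Lemma polygonal_tent g : polygonal g -> {within `[0, 1], continuous g} ->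
  {in `]0, 1[ &, injective g} ->
  (forall t, 0 < t < 1 -> g t <> g 0 /\ g t <> g 1) ->
  exists l : R -> R, [/\ continuous l, l 0 = 0, l 1 = 0,
    forall t, 0 < t < 1 -> 0 < l t <= 1 &
    forall v, polygonal (fun t => g t + l t *: v)].
Proof.
move=> pg cg ginj gends.
have [a [b [m [a0 ab b1 ga [pm lm gb]]]]] := polygonal_ends pg cg ginj gends.
have a1 : a < 1 := le_lt_trans ab b1; have b0 : 0 < b := lt_le_trans a0 ab.
have Da : `|g a - g 0| != 0.
  by rewrite normr_eq0 subr_eq0; apply/eqP; case: (gends a); rewrite ?a0.
have Db : `|g b - g 1| != 0.
  by rewrite normr_eq0 subr_eq0; apply/eqP; case: (gends b); rewrite ?b0.
pose G := g \o @clamp R; have cG : continuous G by exact: continuous_clamp.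
have GE t : 0 <= t <= 1 -> G t = g t by move=> t01; rewrite /G /= clamp_id.
pose al t := `|G (Num.min t a) - g 0| / `|g a - g 0|.
pose be t := `|G (Num.max t b) - g 1| / `|g b - g 1|.
have al1 t : a <= t -> al t = 1.
  by move=> at_; rewrite /al min_r // GE ?divff // (ltW a0) ltW.
have be1 t : t <= b -> be t = 1.
  by move=> tb; rewrite /be max_r // GE ?divff // (ltW b0) ltW.
have alE t s : 0 <= t <= a -> 0 <= s -> g t = g 0 + s *: (g a - g 0) -> al t = s.
  move=> /andP[t0 ta] s0 gt; rewrite /al min_l // GE; last by rewrite t0 (le_trans ta) // ltW.
  by rewrite gt addrAC subrr add0r normrZ ger0_norm // mulfK.
have beE t s : b <= t <= 1 -> s <= 1 -> g t = g b + s *: (g 1 - g b) -> be t = 1 - s.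
  move=> /andP[tb t1] s1 gt; rewrite /be max_l // GE; last by rewrite t1 (le_trans _ tb) // ltW.
  have -> : g t - g 1 = (1 - s) *: (g b - g 1).
    by rewrite gt; apply/rowP => i; rewrite !mxE; ring.
  by rewrite normrZ ger0_norm ?subr_ge0 // mulfK.
have al01 t : 0 < t -> 0 < al t <= 1.
  move=> t0; have [at_|ta] := leP a t; first by rewrite al1 // ltr01 lexx.
  have t01 : 0 < t < 1 by rewrite t0 (lt_trans ta).
  have : segment (g 0) (g a) (g t).
    move: ga => /andP[_ /asboolP <-]; exists t => //=; rewrite in_itv /=; lra.
  move=> /segmentP[s /andP[s0 s1] gt]; rewrite (alE t s) //; last lra.
  rewrite s1 andbT lt_neqAle s0 andbT; apply/eqP => s00.
  by case: (gends t t01) => + _; rewrite gt -s00 scale0r addr0.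
have be01 t : t < 1 -> 0 < be t <= 1.
  move=> t1; have [tb|bt] := leP t b; first by rewrite be1 // ltr01 lexx.
  have t01 : 0 < t < 1 by rewrite t1 (lt_trans _ bt).
  have : segment (g b) (g 1) (g t).
    move: gb => /andP[_ /asboolP <-]; exists t => //=; rewrite in_itv /=; lra.
  move=> /segmentP[s /andP[s0 s1] gt]; rewrite (beE t s) //; last lra.
  rewrite subr_gt0 lt_neqAle s1 andbT gerBl s0 andbT; apply/eqP => s11.
  by case: (gends t t01) => _; rewrite gt s11 scale1r addrC subrK.
have al0 : al 0 = 0.
  by rewrite /al min_l ?(ltW a0) // GE ?lexx ?ler01 // subrr normr0 mul0r.
have be0 : be 1 = 0.
  by rewrite /be max_l ?(ltW b1) // GE ?lexx ?ler01 // subrr normr0 mul0r.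
have cnorm v : continuous (fun x : space => `|x - v|).
  apply: (@lipschitz_continuous _ _ _ 1) => x y; rewrite mul1r.
  by apply: (le_trans (ler_dist_dist _ _)); rewrite opprB addrA subrK.
have cal : continuous al.
  move=> t; apply: cvgMl; have := @continuous_comp _ _ _
    (fun t => G (Num.min t a)) (fun x => `|x - g 0|) t.
  apply; last exact: cnorm.
  have := @continuous_comp _ _ _ (fun t : R => Num.min t a) G t.
  by apply; [exact: min_continuous|exact: cG].
have cbe : continuous be.
  move=> t; apply: cvgMl; have := @continuous_comp _ _ _
    (fun t => G (Num.max t b)) (fun x => `|x - g 1|) t.
  apply; last exact: cnorm.
  have := @continuous_comp _ _ _ (fun t : R => Num.max t b) G t.
  by apply; [exact: max_continuous|exact: cG].
exists (fun t => al t * be t); split.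
- by move=> t; exact: (cvgM (cal t) (cbe t)).
- by rewrite al0 mul0r.
- by rewrite be0 mulr0.
- move=> t /andP[t0 t1]; have /andP[? ?] := al01 t t0; have /andP[? ?] := be01 t t1.
  by rewrite mulr_gt0 //= mulr_ile1 // ltW.
move=> v; apply/polygonalP; exists (a :: rcons m 1); last by rewrite /= last_rcons.
rewrite /= rcons_path lm; apply/and3P; split.
- apply: straight_shear ga _ => t s t0a /andP[s0 s1] gt.
  have /andP[_ ta] := t0a.
  rewrite (alE t s) // al0 (al1 a) // (be1 t) ?(be1 0) ?(be1 a) ?(ltW b0) //.
    by ring.
  exact: le_trans ab.
- have mab t : t \in a :: m -> a <= t <= b.
    exact: (path_mem_le (straight_path_lt pm) lm).
  apply: (@sub_in_path _ (mem (a :: m)) (straight g)) pm => //.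
    move=> x y xm ym gxy; apply: straight_shear gxy _ => t s txy _ _.
    have /andP[ax xb] := mab _ xm; have /andP[ay yb] := mab _ ym.
    have /andP[at_ tb] : a <= t <= b.
      by case/andP: txy => xt ty; rewrite (le_trans ax) // (le_trans ty).
    by rewrite !al1 // !be1 //; ring.
  by apply/allP.
- apply: straight_shear gb _ => t s tb1 /andP[s0 s1] gt.
  have /andP[bt _] := tb1.
  rewrite (beE t s) // be0 (be1 b) // (al1 t) ?(al1 b) ?(al1 1) ?(ltW a1) //.
    by ring.
  exact: le_trans ab bt.
Qed.

End Tent.

(** * Embeddings of the symmetric digraph *)

Section Doubling.
Variables (R : realType) (G : graph).
Notation space := 'rV[R]_3.
Notation DG := (underlying (symmetric_digraph G)).

Lemma tame_polygonal (H : graph) (f : embedding R H) : tame f ->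
  exists h, homeomorphism h /\ exists f' : embedding R H,
    (forall e, polygonal (arc f' e)) /\ forall e, arc f' e = h \o arc f e.
Proof.
move=> [h [hh ph]]; have [ch [k [_ hK _]]] := hh; exists h; split=> //.
have carc e : {within `[0, 1], continuous (h \o arc f e)}.
  by apply: within_continuous_comp ch; exact: arc_continuous.
have h0 e : (h \o arc f e) 0 = (h \o pos f) (ends e).1 by rewrite /= arc0.
have h1 e : (h \o arc f e) 1 = (h \o pos f) (ends e).2 by rewrite /= arc1.
have hpos : injective (h \o pos f).
  by move=> u v /= /(can_inj hK); exact: pos_inj.
have harc e v t : 0 < t < 1 -> (h \o arc f e) t <> (h \o pos f) v.
  by move=> t01 /= /(can_inj hK); exact: arc_pos.
have hinj e e' t t' : 0 < t < 1 -> 0 < t' < 1 ->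
    (h \o arc f e) t = (h \o arc f e') t' -> e = e' /\ t = t'.
  by move=> t01 t'01 /= /(can_inj hK); exact: arc_inj.
by exists (Embedding carc h0 h1 hpos harc hinj).
Qed.

(** Keep one of the two copies of each edge. *)
Lemma tame_restriction : (exists f : embedding R DG, tame f) ->
  exists f : embedding R G, tame f.
Proof.
move=> [f [h [hh ph]]]; pose a (e : edge G) := arc f ((e, false) : edge DG).
have ca e : {within `[0, 1], continuous (a e)} := @arc_continuous _ _ f (e, false).
have a0 e : a e 0 = pos f (ends e).1 := @arc0 _ _ f (e, false).
have a1 e : a e 1 = pos f (ends e).2 := @arc1 _ _ f (e, false).
have apos e v t : 0 < t < 1 -> a e t <> pos f v by exact: arc_pos.
have ainj e e' t t' : 0 < t < 1 -> 0 < t' < 1 -> a e t = a e' t' -> e = e' /\ t = t'.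
  by move=> t01 t'01 /(arc_inj t01 t'01)[[->] ->].
exists (@Embedding R G (pos f) a ca a0 a1 (@pos_inj _ _ f) apos ainj).
by exists h; split=> // e; exact: ph.
Qed.

Lemma arc_interior (H : graph) (f : embedding R H) e t : 0 < t < 1 ->
  arc f e t <> arc f e 0 /\ arc f e t <> arc f e 1.
Proof. by move=> t01; rewrite arc0 arc1; split; exact: arc_pos. Qed.

Lemma arc_interior_inj (H : graph) (f : embedding R H) e :
  {in `]0, 1[ &, injective (arc f e)}.
Proof.
by move=> s t; rewrite !in_itv /= => s01 t01 /(arc_inj s01 t01)[].
Qed.

(** The reversed copy of an edge is the edge moved along its tent in a direction
    [w] common to all edges.  A coincidence of two of the new arcs would make a
    small multiple of [w] lead from one old arc to another, so it would be a
    coincidence of old points, at equal heights. *)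
Lemma doubled_embedding (f : embedding R G) (d : R) :
  (forall e, polygonal (arc f e)) -> 0 < d ->
  exists f' : embedding R DG, (forall e, polygonal (arc f' e)) /\
    forall (e : edge DG) t, 0 <= t <= 1 ->
      exists2 t', 0 <= t' <= 1 & `|arc f e.1 t' - arc f' e t| < d.
Proof.
move=> pf d0.
have /choice[l lP] e := polygonal_tent (pf e) (@arc_continuous _ _ f e)
  (@arc_interior_inj _ f e) (@arc_interior _ f e).
have /choice[L LP] e := polygonal_cover (pf e).
pose S := [seq (pos f v, pos f v) | v <- enum (vertex G)] ++
  flatten [seq L e | e <- enum (edge G)].
have [w [r r0 wr]] := transverse_direction S.
have Spos v : (pos f v, pos f v) \in S.
  by rewrite mem_cat; apply/orP; left; apply: map_f; rewrite mem_enum.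
have Sarc e t : 0 <= t <= 1 -> exists2 p, p \in S & segment p.1 p.2 (arc f e t).
  move=> /(LP e)[p pL pt]; exists p => //; rewrite mem_cat; apply/orP; right.
  by apply/flattenP; exists (L e) => //; apply: map_f; rewrite mem_enum.
pose c := Num.min r (d / (`|w| + 1) / 2).
have w1 : 0 < `|w| + 1 by rewrite ltr_wpDl.
have c0 : 0 < c by rewrite lt_min r0 !divr_gt0.
have cr : c <= r by rewrite ge_min lexx.
have cd : c * `|w| < d.
  apply: (@le_lt_trans _ _ (d / 2)); last lra.
  have : c <= d / (`|w| + 1) / 2 by rewrite ge_min lexx orbT.
  rewrite mulrAC ler_pdivlMr // => ?; have := normr_ge0 w; nra.
have l01 e t : 0 <= t <= 1 -> 0 <= l e t <= 1.
  have [_ l0 l1 l_ _] := lP e; rewrite le_eqVlt => /andP[/predU1P[<- _|t0]].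
    by rewrite l0 lexx ler01.
  rewrite le_eqVlt => /predU1P[->|t1]; first by rewrite l1 lexx ler01.
  by have /andP[/ltW -> ->] : 0 < l e t <= 1 by apply: l_; rewrite t0.
(* Both copies run along [e] in [A]; [a] turns the second one round. *)
pose A e (b : bool) t := arc f e t + (if b then l e t else 0) *: (c *: w).
pose a (e : edge DG) t := A e.1 e.2 (if e.2 then 1 - t else t).
have pA e b : polygonal (A e b).
  rewrite /A; case: b; first by have [_ _ _ _] := lP e; apply.
  congr (polygonal _): (pf e); apply/funext => t; by rewrite scale0r addr0.
have cA e b : {within `[0, 1], continuous (A e b)}.
  pose F t := (arc f e \o @clamp R) t + (if b then l e t else 0) *: (c *: w).
  apply: (@within_clamp _ _ F); last by move=> t t01; rewrite /F /= clamp_id.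
  move=> t; have cl : {for t, continuous (fun t => (if b then l e t else 0) *: (c *: w))}.
    have [cl _ _ _ _] := lP e; case: b @F; last by exact: cvg_cst.
    by move=> ?; apply: cvgZl; exact: cl.
  exact: (cvgD (continuous_clamp (@arc_continuous _ _ f e) (x := t)) cl).
have pa e : polygonal (a e).
  by case: e => e [] /=; [apply: polygonal_rev|]; exact: pA.
have ca e : {within `[0, 1], continuous (a e)}.
  by case: e => e [|]; [exact: (within_rev (cA e true))|exact: (cA e false)].
have Aend e b : A e b 0 = pos f (ends e).1 /\ A e b 1 = pos f (ends e).2.
  have [_ l0 l1 _ _] := lP e.
  by rewrite /A l0 l1 !if_same !scale0r !addr0 arc0 arc1.
have a0 e : a e 0 = pos f (ends e).1.
  case: e => e [|]; rewrite /a /= ?subr0; [exact: (Aend e true).2|].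
  exact: (Aend e false).1.
have a1 e : a e 1 = pos f (ends e).2.
  case: e => e [|]; rewrite /a /= ?subrr; [exact: (Aend e true).1|].
  exact: (Aend e false).2.
have small e (b : bool) t : 0 <= t <= 1 -> 0 <= (if b then l e t else 0) * c <= c.
  move=> /(l01 e)/andP[? ?]; case: b; last by rewrite mul0r lexx (ltW c0).
  by rewrite mulr_ge0 ?(ltW c0) //= ler_piMl // ltW.
have apos e v t : 0 < t < 1 -> a e t <> pos f v.
  rewrite /a; set s := if _ then _ else _ => t01.
  have s01 : 0 < s < 1 by rewrite /s; case: ifP => _ //; lra.
  have s01' : 0 <= s <= 1 by lra.
  have [p pS ps] := Sarc e.1 s s01'.
  rewrite /A scalerA => Apos; apply: (@arc_pos _ _ f e.1 v s s01).
  have /andP[k0 kc] := small e.1 e.2 s s01'; move: k0 kc Apos.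
  set k := _ * c => k0 kc Apos.
  have k_0 : - k = 0.
    apply: (wr _ _ _ _ _ pS (Spos v) ps (segment_left _ _)).
      by rewrite normrN ger0_norm // (le_trans kc).
    by rewrite -Apos opprD addrA subrr add0r scaleNr.
  by rewrite -Apos -[k]opprK k_0 oppr0 scale0r addr0.
have Ainj e e' b b' s s' : 0 < s < 1 -> 0 < s' < 1 -> A e b s = A e' b' s' ->
    [/\ e = e', b = b' & s = s'].
  move=> s01 s'01 AA.
  have [s_ s'_] : 0 <= s <= 1 /\ 0 <= s' <= 1 by split; lra.
  have [p pS ps] := Sarc e s s_; have [p' p'S p's] := Sarc e' s' s'_.
  have /andP[k0 kc] := small e b s s_; have /andP[k'0 k'c] := small e' b' s' s'_.
  move: AA; rewrite /A !scalerA; move: k0 kc k'0 k'c.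
  set k := _ * c; set k' := _ * c => k0 kc k'0 k'c AA.
  have kk : k' - k = 0.
    apply: (wr _ _ _ _ _ pS p'S ps p's).
      by move: k0 kc k'0 k'c cr {AA}; clear; rewrite ler_norml => *; lra.
    have -> : arc f e s = arc f e' s' + k' *: w - k *: w by rewrite -AA addrK.
    by apply/rowP => i; rewrite !mxE; ring.
  have [ee ss] : e = e' /\ s = s'.
    apply: (@arc_inj _ _ f) => //; move: AA; have -> : k' = k by lra.
    by move/addIr.
  split=> //; move: kk; rewrite /k /k' -ee -ss => /eqP.
  have [_ _ _ l_ _] := lP e; have /andP[l0 _] := l_ _ s01.
  rewrite subr_eq0 => /eqP /(mulIf (lt0r_neq0 c0)) {}kk.
  by move: kk l0; case: (b); case: (b') => //= ->; rewrite ltxx.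
have ainj e e' t t' : 0 < t < 1 -> 0 < t' < 1 -> a e t = a e' t' -> e = e' /\ t = t'.
  case: e e' => e b [e' b']; rewrite /a /= => t01 t'01.
  set s := if _ then _ else _; set s' := if _ then _ else _.
  have s01 : 0 < s < 1 by rewrite /s; case: ifP => _ //; lra.
  have s'01 : 0 < s' < 1 by rewrite /s'; case: ifP => _ //; lra.
  move=> /(Ainj _ _ _ _ _ _ s01 s'01)[-> bb ss]; rewrite bb; split=> //.
  by move: ss; rewrite /s /s' bb; case: ifP => _ //; lra.
exists (@Embedding R DG (pos f) a ca a0 a1 (@pos_inj _ _ f) apos ainj); split=> //.
move=> e t t01 /=; set s := if e.2 then 1 - t else t.
have s01 : 0 <= s <= 1 by rewrite /s; case: ifP => _ //; lra.
exists s => //; rewrite /a -/s /A opprD addrA subrr add0r normrN scalerA normrZ.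
have /andP[k0 kc] := small e.1 e.2 s s01; rewrite ger0_norm //.
by apply: le_lt_trans cd; apply: ler_wpM2r.
Qed.

End Doubling.

(** * Directed cycles of the symmetric digraph *)

Section Dicycles.
Local Open Scope set_scope.
Variable G : graph.
Notation DG := (underlying (symmetric_digraph G)).
Implicit Types (C D : {set edge DG}) (L : {set {set edge DG}}) (d : dart G).

Definition flip d : dart G := (d.1, ~~ d.2).

Lemma flipK : involutive flip.
Proof. by case=> e b; rewrite /flip /= negbK. Qed.

Lemma tail_flip d : tail (flip d) = head d.
Proof. by case: d => e []. Qed.

Lemma flip_neq d : flip d <> d.
Proof. by case: d => e []. Qed.

Lemma same_edge d d' : d.1 = d'.1 -> d = d' \/ d = flip d'.
Proof. by case: d d' => [e []] [e' []] /= ->; [left|right|right|left]. Qed.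

Section OneDicycle.
Variables (C : {set edge DG}) (dicycleC : is_dicycle (D := symmetric_digraph G) C).

Lemma dicycle_nonempty : exists d, d \in C.
Proof.
have [s [s0 _ _ Cs]] := dicycleC; case: s s0 Cs => // d s _ Cs.
by exists d; rewrite Cs mem_head.
Qed.

Lemma dicycle_tail_inj : {in C &, injective (@tail G)}.
Proof.
have [s [_ _ us Cs]] := dicycleC.
move=> d d'; rewrite !Cs => ds d's dd'.
elim: s ds d's dd' us {Cs} => //= x s IHs.
rewrite !inE => /predU1P[->|ds] /predU1P[->|d's] // dd' /andP[xs us].
- by case/negP: xs; apply/mapP; exists d'.
- by case/negP: xs; apply/mapP; exists d.
exact: IHs.
Qed.

Lemma dicycle_next d : d \in C -> exists2 d', d' \in C & tail d' = head d.
Proof.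
have [s [_ cs _ Cs]] := dicycleC; rewrite Cs => ds.
exists (next s d); first by rewrite Cs mem_next.
by have := next_cycle cs ds => /eqP.
Qed.

Lemma dicycle_head_inj : {in C &, injective (@head G)}.
Proof.
have [s [_ cs us Cs]] := dicycleC; have us' := map_uniq us.
move=> d d' dC d'C dd'; have ds : d \in s by rewrite -Cs.
have d's : d' \in s by rewrite -Cs.
rewrite -(prev_next us' d) -(prev_next us' d'); congr (prev s _).
apply: dicycle_tail_inj; rewrite ?Cs ?mem_next //.
have /eqP nd := next_cycle cs ds; have /eqP nd' := next_cycle cs d's.
exact: (etrans (esym nd) (etrans dd' nd')).
Qed.

Lemma dicycle_ind (P : pred (dart G)) :
  (exists2 d, d \in C & P d) ->
  {in C &, forall d d', head d = tail d' -> P d -> P d'} -> {in C, forall d, P d}.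
Proof.
have [s [_ cs _ Cs]] := dicycleC.
move=> [d dC Pd] Pstep; have ds : d \in s by rewrite -Cs.
have [i s' sE] := rot_to ds.
have: path.cycle [rel d d' | head d == tail d'] (rot i s) by rewrite rot_cycle.
have Cs' : C =i d :: s' by move=> x; rewrite Cs -sE mem_rot.
rewrite sE /= rcons_path => /andP[ps _] x; rewrite Cs'.
have : all (mem C) (d :: s') by apply/allP => y; rewrite -Cs'.
elim: s' d Pd ps {ds sE dC Cs'} => [|y s' IHs] d Pd /=.
  by move=> _ _; rewrite inE => /eqP->.
move=> /andP[/eqP dy ps] /and3P[dC yC s'C]; rewrite inE => /predU1P[->//|].
by apply: (IHs y) => //=; [exact: Pstep dy Pd|rewrite yC].
Qed.

(** After [d] the only way on is [flip d], and then [d] again; on a loop, [d] and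
    [flip d] would have the same tail. *)
Lemma dicycle_flip d : d \in C -> flip d \in C ->
  {in C, forall d', d'.1 = d.1} /\ (ends d.1).1 <> (ends d.1).2.
Proof.
move=> dC fC; split.
  move=> d' d'C; apply/eqP; move: d' d'C; apply: dicycle_ind; first by exists d.
  move=> x y xC yC xy /eqP /same_edge[]xd.
    have -> // : y = flip d; apply: dicycle_tail_inj => //.
    by rewrite tail_flip -xy xd.
  have -> // : y = d; apply: dicycle_tail_inj => //.
  by rewrite -xy xd -tail_flip flipK.
move=> dd; apply: (@flip_neq d); apply: dicycle_tail_inj => //.
by rewrite tail_flip /tail /head dd.
Qed.

End OneDicycle.

Definition project C : {set edge G} := [set d.1 | d : dart G in C].

Definition simple_dicycle C : Prop :=
  is_dicycle (D := symmetric_digraph G) C /\ forall d, d \in C -> flip d \notin C.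

Lemma simple_dicycle_fst_inj C : simple_dicycle C ->
  {in C &, injective (fun d : dart G => d.1)}.
Proof.
move=> [_ sC] d d' dC d'C /same_edge[//|dd'].
by have := sC d' d'C; rewrite -dd' dC.
Qed.

Lemma project_cycle C : simple_dicycle C -> is_cycle (project C).
Proof.
move=> sC; have [s [s0 cs us Cs]] := sC.1; exists s; split=> //.
  rewrite map_inj_in_uniq ?(map_uniq us) // => d d'; rewrite -!Cs.
  exact: simple_dicycle_fst_inj.
move=> e; apply/imsetP/mapP => -[d ds ->]; exists d => //; first by rewrite -Cs.
by rewrite Cs.
Qed.

(** Where the two dicycles would part, one of them would turn back. *)
Lemma project_sub C D d : simple_dicycle C -> simple_dicycle D ->
  project C = project D -> d \in C -> d \in D -> C \subset D.
Proof.
move=> [dC _] [dD sD] CD dinC dinD; apply/fintype.subsetP.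
apply: (dicycle_ind dC); first by exists d.
move=> x y xC yC xy xD.
have [z zD zx] := dicycle_next dD xD.
have : z.1 \in project C by rewrite CD; apply/imsetP; exists z.
move=> /imsetP[c cC] /same_edge[] zc.
  have <- // : c = y; last by rewrite -zc.
  by apply: (dicycle_tail_inj dC) => //; rewrite -zc zx.
have cx : c = x by apply: (dicycle_head_inj dC) => //; rewrite -zx zc tail_flip.
by have := sD x xD; rewrite -cx -zc zD.
Qed.

Lemma incident_project (d : edge DG) v : incident d v = incident (G := G) d.1 v.
Proof. by case: d => e [] //; rewrite /incident /= orbC. Qed.

Lemma incident_tail (d : edge DG) : incident d (tail d).
Proof. by rewrite /incident eqxx. Qed.

Definition oriented_link n L : Prop :=
  is_link n L /\ forall C, C \in L -> simple_dicycle C.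

Definition project_link L : {set {set edge G}} := [set project C | C in L].

Lemma link_common_edge n L C D d d' : is_link n L -> C \in L -> D \in L ->
  d \in C -> d' \in D -> d.1 = d'.1 -> C = D.
Proof.
move=> [_ _ disjL] CL DL dC dD dd; apply/eqP; apply: contrapT => /negP CD.
have := disjL C D CL DL CD d d' (tail d) dC dD.
by rewrite incident_tail incident_project -dd -incident_project incident_tail.
Qed.

Lemma project_inj n L : oriented_link n L -> {in L &, injective project}.
Proof.
move=> [lL sL] C D CL DL CD; have [d dC] := dicycle_nonempty (sL C CL).1.
have : d.1 \in project D by rewrite -CD; apply/imsetP; exists d.
by move=> /imsetP[d' d'D]; exact: link_common_edge lL CL DL dC d'D.
Qed.

Lemma project_link_is_link n L : oriented_link n L -> is_link n (project_link L).
Proof.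
move=> oL; have [[cardL _ disjL] sL] := oL; split.
- by rewrite card_in_imset //; exact: project_inj oL.
- by move=> _ /imsetP[C CL ->]; exact/project_cycle/sL.
move=> _ _ /imsetP[C CL ->] /imsetP[D DL ->] CD e e' v.
move=> /imsetP[d dC ->] /imsetP[d' d'D ->].
rewrite -!incident_project; apply: disjL dC d'D => //.
by apply: contraNneq CD => ->.
Qed.

(** An arbitrary reference edge on each cycle of [project_link L] is enough to
    record which way the cycle is followed. *)
Definition orientation L : {set {set edge G}} :=
  [set X in project_link L |
    if [pick e in X] is Some e then (e, false) \in finset.cover L else false].

Lemma orientation_inj n L L' : oriented_link n L -> oriented_link n L' ->
  project_link L = project_link L' -> orientation L = orientation L' -> L \subset L'.
Proof.
move=> oL oL' pLL' oLL'; apply/fintype.subsetP => C CL.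
have pC : project C \in project_link L by exact: imset_f.
have : project C \in project_link L' by rewrite -pLL'.
move=> /imsetP[D DL' CD]; suff -> : C = D by [].
have [sC sD] := (oL.2 C CL, oL'.2 D DL').
have [e eC pickE] : exists2 e, e \in project C & [pick e in project C] = Some e.
  case: pickP => [e eC|no]; first by exists e.
  have [d dC] := dicycle_nonempty sC.1.
  by have := no d.1; rewrite (imset_f (fun d : dart G => d.1) dC).
have eD : e \in project D by rewrite -CD.
have coverE M E : oriented_link n M -> E \in M -> e \in project E ->
    (((e, false) : dart G) \in finset.cover M) = (((e, false) : dart G) \in E).
  move=> [lM _] EM /imsetP[d dE ed]; apply/bigcupP/idP => [[F FM eF]|eE].
    by rewrite (link_common_edge lM EM FM dE eF) // -ed.
  by exists E.
have falseE : (((e, false) : dart G) \in C) = (((e, false) : dart G) \in D).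
  rewrite -(coverE L C oL CL eC) -(coverE L' D oL' DL' eD).
  have : (project C \in orientation L) = (project C \in orientation L') by rewrite oLL'.
  by rewrite !inE pickE -pLL' pC.
have trueE E : e \in project E -> ((e, false) : dart G) \notin E ->
    ((e, true) : dart G) \in E.
  by move=> /imsetP[[e' []] dE ->] //=; rewrite dE.
have [d dC dD] : exists2 d, d \in C & d \in D.
  have [eC0|eC0] := boolP (((e, false) : dart G) \in C).
    by exists (e, false); rewrite // -falseE.
  by exists (e, true); [exact: trueE eC0|apply: trueE => //; rewrite -falseE].
apply/eqP; rewrite finset.eqEsubset; apply/andP; split.
  exact: project_sub dC dD.
exact: project_sub dD dC.
Qed.

(** Each component of a link has two orientations. *)
Lemma oriented_link_count n (A : {set {set {set edge DG}}})
    (B : {set {set {set edge G}}}) :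
  (forall L, L \in A -> oriented_link n L /\ project_link L \in B) ->
  (#|A| <= #|B| * 2 ^ n)%N.
Proof.
move=> AB; pose B' := [set L in B | #|L| == n].
have AB' L : L \in A -> project_link L \in B'.
  move=> /AB[oL LB]; rewrite inE LB /=; apply/eqP.
  by case: (project_link_is_link oL).
pose T := [set p : {set {set edge G}} * {set {set edge G}} |
  (p.1 \in B') && (p.2 \subset p.1)].
apply: (@leq_trans #|T|).
  rewrite -(@card_in_imset _ _ (fun L => (project_link L, orientation L)) A).
    apply/subset_leq_card/fintype.subsetP => _ /imsetP[L LA ->]; rewrite inE /= AB' //=.
    by apply/fintype.subsetP => X; rewrite inE => /andP[].
  move=> L L' LA L'A [pLL' oLL']; have [[oL _] [oL' _]] := (AB L LA, AB L' L'A).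
  apply/eqP; rewrite finset.eqEsubset (orientation_inj oL oL') //.
  by rewrite (orientation_inj oL' oL).
have -> : #|T| = (\sum_(L in B') \sum_(X : {set {set edge G}} | X \subset L) 1)%N.
  by rewrite pair_big_dep /= sum1dep_card.
rewrite (eq_bigr (fun=> 2 ^ n)%N); last first.
  move=> L; rewrite inE => /andP[_ /eqP Ln].
  by rewrite sum1dep_card -Ln -card_powerset; apply: eq_card => X; rewrite !inE.
rewrite sum_nat_const leq_mul2r; apply/orP; right; apply/subset_leq_card/fintype.subsetP => L.
by rewrite inE => /andP[].
Qed.

End Dicycles.

(** * Split links and their doubles *)

Section Splitting.
Variable R : realType.
Notation space := 'rV[R]_3.

Lemma componentP (H : graph) (f : embedding R H) (X : {set edge H}) x :
  component f X x <->
  exists e t, [/\ e \in X, 0 <= t <= 1 & x = arc f e t].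
Proof.
split=> [[e /= eX [t /= t01 <-]]|[e [t [eX t01 ->]]]].
  by exists e, t; split=> //; rewrite in_itv /= in t01.
by exists e => //; exists t; rewrite //= in_itv.
Qed.

Lemma component_sub (H : graph) (f : embedding R H) (X Y : {set edge H}) :
  X \subset Y -> component f X `<=` component f Y.
Proof.
move=> /fintype.subsetP XY x /componentP[e [t [eX t01 ->]]].
by apply/componentP; exists e, t; split=> //; exact: XY.
Qed.

Lemma component_compact (H : graph) (f : embedding R H) (X : {set edge H}) :
  compact (component f X).
Proof.
have -> : component f X = \big[setU/set0]_(e <- enum X) (arc f e @` `[0, 1]).
  rewrite -bigcup_seq; apply: eq_bigcupl.
  by split=> e /=; rewrite mem_enum.
apply: bigsetU_compact => e _; apply: continuous_compact; last exact: segment_compact.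
exact: arc_continuous.
Qed.

Lemma split_cover (H : graph) (f : embedding R H) (L : {set {set edge H}}) :
  Defs.split f L <-> exists A : {set {set edge H}},
    [/\ A != finset.set0, A \proper L &
      split_apart (component f (finset.cover A))
                  (component f (finset.cover (finset.setD L A)))].
Proof.
split=> [[S [A [eS LS A0 AL sepS]]]|[A [A0 AL [S [eS AS LS sepS]]]]].
  have sAL := proper_sub AL.
  exists A; split=> //; exists S; split=> //.
  - rewrite -subset0 => x [/componentP[e [t [/bigcupP[C CA eC] t01 xE]]] Sx].
    rewrite -(LS C (fintype.subsetP sAL C CA)); split=> //.
    by apply/componentP; exists e, t.
  - rewrite -subset0 => x [/componentP[e [t [/bigcupP[C]]]]].
    rewrite finset.in_setD => /andP[CA CL] eC t01 xE Sx.
    by rewrite -(LS C CL); split=> //; apply/componentP; exists e, t.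
  move=> x y /componentP[e [t [/bigcupP[C CA eC] t01 xE]]].
  move=> /componentP[e' [t' [/bigcupP[C']]]].
  rewrite finset.in_setD => /andP[C'A C'L] e'C' t'01 yE.
  apply: (sepS C C' CA C'L C'A).
    by apply/componentP; exists e, t.
  by apply/componentP; exists e', t'.
have inA C : C \in A -> component f C `<=` component f (finset.cover A).
  by move=> CA; apply/component_sub/finset.bigcup_sup.
have inLA C : C \in L -> C \notin A ->
    component f C `<=` component f (finset.cover (finset.setD L A)).
  move=> CL CA; apply/component_sub/finset.bigcup_sup.
  by rewrite finset.in_setD CA.
exists S, A; split=> //.
  move=> C CL; rewrite -subset0 => x [xC Sx].
  have [CA|CA] := boolP (C \in A); first by rewrite -AS; split=> //; exact: inA CA _ _.
  by rewrite -LS; split=> //; exact: inLA CL CA _ _.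
move=> C C' CA C'L C'A x y xC yC'; apply: sepS; first exact: inA CA _ _.
exact: inLA C'L C'A _ _.
Qed.

Lemma split_homeomorphism (H : graph) (f f' : embedding R H) h
    (L : {set {set edge H}}) :
  homeomorphism h -> (forall e, arc f' e = h \o arc f e) ->
  Defs.split f L -> Defs.split f' L.
Proof.
move=> hh ff' /split_cover[A [A0 AL sA]]; apply/split_cover; exists A; split=> //.
have fE X : component f' X = h @` component f X.
  apply/seteqP; split=> x.
    move=> /componentP[e [t [eX t01 ->]]]; exists (arc f e t); last by rewrite ff'.
    by apply/componentP; exists e, t.
  move=> [_ /componentP[e [t [eX t01 ->]]] <-]; apply/componentP; exists e, t.
  by rewrite ff'.
by rewrite !fE; exact: split_apart_homeomorphism.
Qed.

Lemma arc_meet (H : graph) (f : embedding R H) e e' t t' :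
  0 <= t <= 1 -> 0 <= t' <= 1 -> arc f e t = arc f e' t' ->
  exists v, incident e v /\ incident e' v.
Proof.
have ends01 s : 0 <= s <= 1 -> forall e0, 0 < s < 1 \/
    exists2 v, incident e0 v & arc f e0 s = pos f v.
  rewrite le_eqVlt => /andP[/predU1P[<- _|s0]] => [e0|].
    by right; exists (ends e0).1; rewrite ?arc0 // /incident eqxx.
  rewrite le_eqVlt => /predU1P[->|s1] e0; last by left; rewrite s0.
  by right; exists (ends e0).2; rewrite ?arc1 // /incident eqxx orbT.
move=> /ends01/(_ e)[t01|[v ev tv]] /ends01/(_ e')[t'01|[v' e'v' t'v']].
- move=> /(arc_inj t01 t'01)[-> _]; exists (ends e').1.
  by rewrite /incident eqxx.
- by rewrite t'v' => /(arc_pos t01).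
- by rewrite tv => /esym /(arc_pos t'01).
by rewrite tv t'v' => /pos_inj vv'; exists v; rewrite {2}vv'.
Qed.

Lemma nonloop_arc_inj (H : graph) (f : embedding R H) e :
  (ends e).1 <> (ends e).2 -> set_inj `[0, 1] (arc f e).
Proof.
move=> loop s t; rewrite !inE /= !in_itv /= => s01 t01 st.
have inner x y : 0 < x < 1 -> 0 <= y <= 1 -> arc f e x = arc f e y -> x = y.
  move=> x01 /andP[]; rewrite le_eqVlt => /predU1P[<- _|y0].
    by move/(@arc_interior _ _ f e x x01).1.
  rewrite le_eqVlt => /predU1P[->|y1]; first by move/(@arc_interior _ _ f e x x01).2.
  by move/(arc_inj x01) => []; rewrite ?y0.
have [?|sN] := boolP (0 < s < 1); first exact: inner.
have [?|tN] := boolP (0 < t < 1); first by apply/esym; exact: inner.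
have end01 (x : R) : 0 <= x <= 1 -> ~~ (0 < x < 1) -> x = 0 \/ x = 1.
  rewrite le_eqVlt => /andP[/predU1P[<-|x0]]; first by left.
  rewrite le_eqVlt => /predU1P[->|x1]; first by right.
  by rewrite x0 x1.
have [[sE|sE] [tE|tE]] := (end01 s s01 sN, end01 t t01 tN); rewrite sE tE // in st *.
  by move: st; rewrite arc0 arc1 => /pos_inj.
by move: st; rewrite arc0 arc1 => /esym /pos_inj.
Qed.

(** The edges of [Y] form a closed set that misses the arc of [e], and this arc
    can be shrunk as it is not closed. *)
Lemma edge_split_apart (H : graph) (f : embedding R H) e (Y : {set edge H}) :
  polygonal (arc f e) -> (ends e).1 <> (ends e).2 ->
  (forall e' v, e' \in Y -> ~~ (incident e v && incident e' v)) ->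
  split_apart (component f (finset.set1 e)) (component f Y).
Proof.
move=> pe loop eY.
apply: (@split_apart_sub _ (arc f e @` `[0, 1]) _ (component f Y)) => //.
  move=> x /componentP[e' [t [/set1P-> t01 ->]]].
  by exists t; rewrite //= in_itv.
apply: split_apart_arc => //.
- exact: arc_continuous.
- exact: nonloop_arc_inj.
- by apply: compact_closed; [exact: norm_hausdorff|exact: component_compact].
rewrite -subset0 => _ [[t /= t01 <-] /componentP[e' [t' [e'Y t'01]]]].
rewrite in_itv /= in t01.
move=> /(arc_meet t01 t'01)[v [ev e'v]].
by have := eY e' v e'Y; rewrite ev e'v.
Qed.

Lemma near_set_le (d d' : R) (P P' : set space) :
  d' <= d -> near_set d' P P' -> near_set d P P'.
Proof.
move=> dd PP' x /PP'[y Py xy]; exists y => //; exact: lt_le_trans xy dd.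
Qed.

Lemma split_apart_radius (H : graph) (f : embedding R H) :
  exists2 d : R, 0 < d & forall (X Y : {set edge H}) (P Q : set space),
    split_apart (component f X) (component f Y) ->
    near_set d (component f X) P -> near_set d (component f Y) Q -> split_apart P Q.
Proof.
have [||d d0 dP] := @common_radius R _
  (enum {: {set edge H} * {set edge H}}) (fun p d =>
    split_apart (component f p.1) (component f p.2) -> forall P Q,
    near_set d (component f p.1) P -> near_set d (component f p.2) Q ->
    split_apart P Q).
- move=> p r r' rr' Pr pp P Q nP nQ; apply: Pr => //.
    exact: near_set_le nP.
  exact: near_set_le nQ.
- move=> p _; have [pp|pp] := pselect (split_apart (component f p.1) (component f p.2)).
    have [d d0 dP] := split_apart_near (@component_compact _ f p.1)
      (@component_compact _ f p.2) pp.
    by exists d.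
  by exists 1.
exists d => // X Y P Q XY nP nQ.
by apply: (dP (X, Y)) nP nQ => //; rewrite mem_enum.
Qed.

End Splitting.

(** * The bound *)

Section Bound.
Variables (R : realType) (G : graph).
Notation DG := (underlying (symmetric_digraph G)).

(** All that remains of the geometry of the doubling: splittings of sets of edges
    of [G] survive in sets of copies of these edges. *)
Definition double_of (f : embedding R G) (f' : embedding R DG) : Prop :=
  forall (X Y : {set edge G}) (X' Y' : {set edge DG}),
    split_apart (component f X) (component f Y) ->
    (forall d : edge DG, d \in X' -> d.1 \in X) ->
    (forall d : edge DG, d \in Y' -> d.1 \in Y) ->
    split_apart (component f' X') (component f' Y').

Lemma exists_double (f : embedding R G) : (forall e, polygonal (arc f e)) ->
  exists f' : embedding R DG, (forall e, polygonal (arc f' e)) /\ double_of f f'.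
Proof.
move=> pf; have [d d0 dP] := split_apart_radius f.
have [f' [pf' ff']] := doubled_embedding pf d0.
exists f'; split=> // X Y X' Y' XY X'X Y'Y.
have near (Z : {set edge G}) (Z' : {set edge DG}) :
    (forall d : edge DG, d \in Z' -> d.1 \in Z) ->
    near_set d (component f Z) (component f' Z').
  move=> Z'Z _ /componentP[e [t [eZ' t01 ->]]].
  have [t' t'01 tt'] := ff' e t t01; exists (arc f e.1 t') => //.
  by apply/componentP; exists e.1, t'; split=> //; exact: Z'Z.
by apply: dP XY _ _; exact: near.
Qed.

Variables (f : embedding R G) (f' : embedding R DG).
Hypotheses (pf : forall e, polygonal (arc f e)) (ff' : double_of f f').
Implicit Types (L : {set {set edge DG}}) (C : {set edge DG}).

Lemma project_split L : Defs.split f (project_link L) -> Defs.split f' L.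
Proof.
move=> /split_cover[A [A0 AL sA]]; apply/split_cover.
pose A' := [set C in L | project C \in A]%SET.
have A'P C : (C \in A') = (C \in L) && (project C \in A) by rewrite inE.
exists A'; split.
- have /finset.set0Pn[X XA] := A0.
  have /imsetP[C CL XC] := fintype.subsetP (proper_sub AL) X XA.
  by apply/finset.set0Pn; exists C; rewrite A'P CL -XC.
- have /properP[_ [X XL XA]] := AL; apply/properP; split.
    by apply/fintype.subsetP => C; rewrite A'P => /andP[].
  by have /imsetP[C CL XC] := XL; exists C; rewrite // A'P CL -XC.
apply: ff' sA _ _ => d /bigcupP[C].
  rewrite A'P => /andP[_ CA] dC; apply/bigcupP; exists (project C) => //.
  exact: imset_f.
rewrite finset.in_setD A'P => /andP[+ CL] dC; rewrite CL /= => CA.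
apply/bigcupP; exists (project C); last exact: imset_f.
by rewrite finset.in_setD CA; exact: imset_f.
Qed.

(** Both arcs of a two-way dicycle lie close to one edge, around which there is a
    sphere that leaves out all edges disjoint from it. *)
Lemma two_way_split n L C (d : dart G) : (2 <= n)%N -> is_link n L ->
  C \in L -> is_dicycle (D := symmetric_digraph G) C ->
  d \in C -> flip d \in C -> Defs.split f' L.
Proof.
move=> n2 lL CL dC dinC fdC; have [cardL _ disjL] := lL.
have [Cd loop] := dicycle_flip dC dinC fdC.
have [D DL DC] : exists2 D, D \in L & D != C.
  have : (0 < #|L :\ C|)%N by move: n2; rewrite -cardL (cardsD1 C) CL.
  by move=> /card_gt0P[D]; rewrite !inE => /andP[DC DL]; exists D.
pose Y := [set e | [forall v, ~~ (incident d.1 v && incident e v)]]%SET.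
apply/split_cover; exists [set C]%SET; split.
- by apply/finset.set0Pn; exists C; rewrite finset.set11.
- apply/properP; split; first by rewrite finset.sub1set.
  by exists D; rewrite // finset.in_set1.
apply: (ff' (X := [set d.1]%SET) (Y := Y)).
- apply: edge_split_apart => // e v; rewrite inE => /forallP; exact.
- by move=> x /bigcupP[E]; rewrite !finset.in_set1 => /eqP-> /Cd ->.
move=> x /bigcupP[E]; rewrite finset.in_setD finset.in_set1 => /andP[EC EL] xE.
rewrite inE; apply/forallP => v; rewrite -!incident_project.
by apply: disjL dinC xE => //; rewrite eq_sym.
Qed.

Lemma nb_oriented_le n : (2 <= n)%N ->
  (nb_oriented_nonsplit_links n (D := symmetric_digraph G) f' <=
   nb_nonsplit_links n f * 2 ^ n)%N.
Proof.
move=> n2; rewrite /nb_oriented_nonsplit_links /nb_nonsplit_links.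
rewrite -(cardsE [pred L | _]) -[X in (_ <= X * _)%N](cardsE [pred L | _]).
apply: oriented_link_count => L LA.
move: LA; rewrite finset.in_set => /asboolP[lL oL nsL].
have sL : oriented_link n L.
  split=> // C CL; split; first exact: oL.
  move=> d dC; apply/negP => fdC; apply: nsL.
  exact: two_way_split lL CL (oL C CL) dC fdC.
split=> //; rewrite finset.in_set; apply/asboolP; split; first exact: project_link_is_link.
by move=> /project_split.
Qed.

End Bound.

Lemma minimumP (A : set nat) k : A k ->
  A (minimum A) /\ forall m, A m -> (minimum A <= m)%N.
Proof.
move=> Ak; have exA : exists m, `[< A m >] by exists k; exact/asboolP.
have [m /asboolP Am mmin] := ex_minnP exA.
suff : [set k | A k /\ forall m, A m -> (k <= m)%N] (minimum A) by [].
by apply: (@xgetPex _ 0%N); exists m; split=> // i Ai; apply: mmin; exact/asboolP.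
Qed.

Theorem corollary7p3 (R : realType) (n : nat) (hn : (2 <= n)%N) (G : graph) :
  (dmnl R n (symmetric_digraph G) <= mnl R n G * 2 ^ n)%N.
Proof.
(* Without tame embeddings both minima have the default value 0. *)
have [[f0 tf0]|noG] := pselect (exists f : embedding R G, tame f); last first.
  rewrite /dmnl /minimum xgetPN // => k [[f tf _] _].
  by apply/noG/tame_restriction; exists f.
have [|[f tf fE] _] := @minimumP [set nb_nonsplit_links n f | f in @tame R G]
  (nb_nonsplit_links n f0); first by exists f0.
rewrite /mnl -fE.
have [h [hh [f1 [pf1 f1E]]]] := tame_polygonal tf.
have [f' [pf' ff']] := exists_double pf1.
have tf' : tame f' by exists id; split=> //; exact: homeomorphism_id.
have nbf' : [set nb_oriented_nonsplit_links n f | f in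
    @tame R (underlying (symmetric_digraph G))] (nb_oriented_nonsplit_links n f').
  by exists f'.
apply: (leq_trans ((minimumP nbf').2 _ nbf')).
apply: (leq_trans (nb_oriented_le pf1 ff' hn)).
rewrite leq_mul2r; apply/orP; right; rewrite /nb_nonsplit_links.
apply: subset_leq_card; apply/fintype.subsetP => L.
move=> /asboolP[lL nsL]; apply/asboolP; split=> // sL; apply: nsL.
exact: split_homeomorphism hh f1E sL.
Qed.
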